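(* Suppose that $h(u)>0$ for all $u\in[0,1]$ and $$H(1) \le \left(k(p) \int_{0}^1 D^{p'-1}(u)\, g(u)\,\mathrm{d} u\right)^{\frac{1}{p'}}.$$ Let $c^*$ denote the unique $c>-h_m$ (whose existence is part of the assertion) such that the boundary value problem $$\begin{cases}\left(D(u)|u'|^{p-2}u'\right)' +\left(c+h(u)\right)u' +g(u)=0 \quad \text{on } \mathbb{R},\\ u(-\infty)=1,\quad u(+\infty)=0\end{cases}$$ has a unique (up to translation) solution (in the sense defined in the context). Then $$c^*>0>-h_m.$$
   Context: Standing assumptions and notation. $p>1$ is real and $p'=\frac{p}{p-1}$. $D\in C^1(0,1)$ with $D>0$ in $(0,1)$ ($D$ may degenerate or be singular at $0$ and/or $1$). $h\in C[0,1]$, $H(u)=\int_0^u h(s)\,\mathrm{d}s$ (so $H\in C^1[0,1]$, $H(0)=0$), and $h_m=\min_{u\in[0,1]}h(u)$. $\theta\in(0,1)$, and $g\in C[0,1]$ satisfies $g=0$ in $[0,\theta]$, $g>0$ in $(\theta,1)$, $g(1)=0$. It is assumed that $\int_0^1 D^{p'-1}(u)g(u)\,\mathrm{d}u<+\infty$. The constant $k(p)$ is $$k(p)=\begin{cases}\dfrac{1}{2^{p'-1}-1} & \text{if } 1<p<2,\\[2mm] 1 & \text{if } p=2,\\[2mm] \dfrac{p'}{p'-1+\hat k(p')} & \text{if } p>2,\end{cases}\qquad \hat k(r)=\frac{1+r(r-1)^{\frac{1}{r-2}}+(r-1)^{\frac{r}{r-2}}}{\left(1+(r-1)^{\frac{1}{r-2}}\right)^{r}}\quad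 (1<r<2).$$ Definition of solution. For given $c\in\mathbb{R}$, a continuous function $u:\mathbb{R}\to[0,1]$ is a solution of the boundary value problem if: (a) $u\in C^1(I_u)$, where $I_u=\{\xi\in\mathbb{R}: 0<u(\xi)<1\}$, and the equation holds at every point of $I_u$ (in particular $\xi\mapsto D(u(\xi))|u'(\xi)|^{p-2}u'(\xi)$ belongs to $C^1(I_u)$); (b) the function $\xi\mapsto D(u(\xi))|u'(\xi)|^{p-2}u'(\xi)$ (understood as $0$ at points where $u\in\{0,1\}$) is continuous on $\mathbb{R}$, and $D(u(\xi))|u'(\xi)|^{p-2}u'(\xi)\to 0$ as $u(\xi)\to 0$ and as $u(\xi)\to 1$; (c) $u(\xi)\to 1$ as $\xi\to-\infty$ and $u(\xi)\to 0$ as $\xi\to+\infty$. ''Unique up to translation'' means that any two solutions $u_1,u_2$ satisfy $u_2(\xi)=u_1(\xi+a)$ for all $\xi\in\mathbb{R}$, for some $a\in\mathbb{R}$. *)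

(* Defs.v *)
From Stdlib Require Import Reals.
From Coquelicot Require Import Coquelicot.
Open Scope R_scope.

Definition unit_itv (u : R) : Prop := 0 <= u <= 1.
Definition open_unit_itv (u : R) : Prop := 0 < u < 1.

(** [C^1] on an open set [A]: two-sided derivatives at the points of [A]. *)
Definition C1_on (A : R -> Prop) (f : R -> R) : Prop :=
  forall x, A x -> ex_derive f x /\ continuous (Derive f) x.

Definition is_min_on (A : R -> Prop) (f : R -> R) (m : R) : Prop :=
  (exists x, A x /\ f x = m) /\ (forall x, A x -> m <= f x).

Definition conj_exp (p : R) : R := p / (p - 1).

Definition cap_H (h : R -> R) (u : R) : R := RInt h 0 u.

Definition k_hat (r : R) : R :=
  (1 + r * Rpower (r - 1) (1 / (r - 2)) + Rpower (r - 1) (r / (r - 2)))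
  / Rpower (1 + Rpower (r - 1) (1 / (r - 2))) r.

Definition k_const (p : R) : R :=
  if Rlt_dec p 2 then 1 / (Rpower 2 (conj_exp p - 1) - 1)
  else if Req_EM_T p 2 then 1
  else conj_exp p / (conj_exp p - 1 + k_hat (conj_exp p)).

(** [D^(p'-1) g]; [D] is only meaningful on (0,1), so the integral over (0,1)
    is taken as an improper one at both endpoints. *)
Definition weight (p : R) (D g : R -> R) (u : R) : R :=
  Rpower (D u) (conj_exp p - 1) * g u.

Definition weight_integrable (p : R) (D g : R -> R) : Prop :=
  ex_RInt_gen (weight p D g) (at_right 0) (at_left 1).

Definition weight_integral (p : R) (D g : R -> R) : R :=
  RInt_gen (weight p D g) (at_right 0) (at_left 1).

(** [|s|^(p-2) s]. At [s = 0] the value is 0, as it should be for [p > 1]: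
    [Rpower] is total and finite, and its junk value is multiplied by 0. *)
Definition p_power (p s : R) : R := Rpower (Rabs s) (p - 2) * s.

Definition flux (p : R) (D u : R -> R) (xi : R) : R :=
  D (u xi) * p_power p (Derive u xi).

Definition flux_ext (p : R) (D u : R -> R) (xi : R) : R :=
  if Rlt_dec 0 (u xi) then
    if Rlt_dec (u xi) 1 then flux p D u xi else 0
  else 0.

Definition I_set (u : R -> R) (xi : R) : Prop := 0 < u xi < 1.

(** [f xi -> 0] as [u xi -> a]. *)
Definition vanishes_as (f u : R -> R) (a : R) : Prop :=
  forall eps, 0 < eps -> exists delta, 0 < delta /\
    forall xi, Rabs (u xi - a) < delta -> Rabs (f xi) < eps.

Record is_solution (p : R) (D h g : R -> R) (c : R) (u : R -> R) : Prop := {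
  sol_range : forall xi, 0 <= u xi <= 1;
  sol_continuous : forall xi, continuous u xi;
  sol_C1 : C1_on (I_set u) u;
  sol_flux_C1 : C1_on (I_set u) (flux p D u);
  sol_equation : forall xi, I_set u xi ->
    Derive (flux p D u) xi + (c + h (u xi)) * Derive u xi + g (u xi) = 0;
  sol_flux_continuous : forall xi, continuous (flux_ext p D u) xi;
  sol_flux_at_0 : vanishes_as (flux_ext p D u) u 0;
  sol_flux_at_1 : vanishes_as (flux_ext p D u) u 1;
  sol_lim_left : is_lim u m_infty 1;
  sol_lim_right : is_lim u p_infty 0
}.

Definition has_unique_solution (p : R) (D h g : R -> R) (c : R) : Prop :=
  (exists u, is_solution p D h g c u) /\
  (forall u1 u2, is_solution p D h g c u1 -> is_solution p D h g c u2 ->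
     exists a, forall xi, u2 xi = u1 (xi + a)).

(* Main.v *)
Require Import Defs.
From Stdlib Require Import Reals Lra Lia IndefiniteDescription.
From Coquelicot Require Import Coquelicot.
Open Scope R_scope.

(** Along a solution with [c + h > 0] on [[0, 1]], the flux plus [c u + H(u)] is
    nonincreasing, which forces [u] to be strictly decreasing where [0 < u < 1]. So [u]
    is determined up to translation by [z(s) = D |u'|^(p-1)] at [u = s], which solves
    [z' = c + h - f / z^(p'-1)] with [f = D^(p'-1) g], [z = c s + H(s)] on [[0, theta]] and
    [z(1) = 0]. Two such trajectories repel each other forward, so there is at most one
    speed and, for this speed, one [z]. Conversely [Y = z^p'] is obtained by solving
    [Y' = p' ((c + h) Y^(1/p) - f)] backward from [Y(1) = 0], where the flow is
    nonexpansive, and [c > 0] by the intermediate value theorem from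
    [Y(theta) = (c theta + H(theta))^p']. The sign at [c = 0] comes from
    [H(1)^p' < p' * int f], which is weaker than the hypothesis because [k(p) <= 1]. *)

(** * One-sided differential inequalities *)

(** Throughout, [q = p' - 1 = 1 / (p - 1)], so [q + 1 = p'] and [q / (q + 1) = 1 / p]. Two obstacles
    shape the existence half: [D^q] may blow up at 1, so [f] need not be bounded, and the power
    [1 / p] is not Lipschitz at 0. The first is removed by subtracting [P(u) = p' * int_u^1 f],
    which is finite by the integrability assumption: [W = P - Y] solves an equation with continuous
    bounded data. For the second, monotonicity in the unknown replaces the Lipschitz condition; one
    comparison estimate yields convergence of approximations, uniqueness and continuous dependence
    on [c]. In the other half, nothing is known beforehand about the monotonicity of a solution [u],
    and [u] may reach 0 or 1 at finite points, where the equation is not assumed. Sign conditions on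
    derivatives are therefore required only while the function takes values in a band that avoids
    the exceptional levels. *)

Lemma continuous_eps (f : R -> R) (x : R) : continuous f x <->
  forall eps, 0 < eps -> exists d, 0 < d /\
    forall y, Rabs (y - x) < d -> Rabs (f y - f x) < eps.
Proof.
  split.
  - intros Hf eps Heps.
    destruct (proj1 (filterlim_locally f (f x)) Hf (mkposreal eps Heps)) as [d Hd].
    exists d; split; [apply cond_pos|].
    intros y Hy; exact (Hd y Hy).
  - intros Hf; apply filterlim_locally; intros [eps Heps].
    destruct (Hf eps Heps) as [d [Hd Hy]].
    exists (mkposreal d Hd); intros y By; exact (Hy y By).
Qed.

Lemma last_below (f : R -> R) (x y m : R) :
  x <= y -> (forall t, x <= t <= y -> continuous f t) -> f x <= m < f y ->
  exists t0, x <= t0 < y /\ f t0 = m /\ forall t, t0 < t <= y -> m < f t.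
Proof.
  intros Hxy Hc [Hx Hy].
  destruct (completeness (fun t => x <= t <= y /\ f t <= m)) as [s [Hub Hlub]].
  - exists y; intros t [Ht _]; lra.
  - exists x; repeat split; lra.
  - assert (Hxs : x <= s) by (apply Hub; repeat split; lra).
    assert (Hsy : s <= y) by (apply Hlub; intros t [Ht _]; lra).
    assert (Habove : forall t, s < t <= y -> m < f t).
    { intros t Ht; destruct (Rlt_le_dec m (f t)) as [|Hle]; [assumption|].
      assert (t <= s) by (apply Hub; repeat split; lra); lra. }
    assert (Hs1 : f s <= m).
    { destruct (Rle_lt_dec (f s) m) as [|Hlt]; [assumption|exfalso].
      destruct (proj1 (continuous_eps f s) (Hc s (conj Hxs Hsy)) (f s - m)) as [d [Hd Hball]];
        [lra|].
      assert (s <= s - d / 2); [|lra].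
      apply Hlub; intros t [Ht Hft].
      assert (t <= s) by (apply Hub; repeat split; lra).
      destruct (Rle_lt_dec t (s - d / 2)) as [|Hts]; [assumption|exfalso].
      assert (Hb : Rabs (f t - f s) < f s - m) by (apply Hball, Rabs_def1; lra).
      apply Rabs_def2 in Hb; lra. }
    assert (Hsy' : s < y).
    { destruct Hsy as [|Heq]; [assumption|]. rewrite Heq in Hs1; lra. }
    exists s; repeat split; try assumption.
    apply Rle_antisym; [assumption|].
    destruct (Rle_lt_dec m (f s)) as [|Hlt]; [assumption|exfalso].
    destruct (proj1 (continuous_eps f s) (Hc s (conj Hxs Hsy)) (m - f s)) as [d [Hd Hball]];
      [lra|].
    set (t := Rmin y (s + d / 2)).
    assert (Ht : s < t <= y /\ t <= s + d / 2).
    { unfold t; repeat split; [apply Rmin_glb_lt; lra|apply Rmin_l|apply Rmin_r]. }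
    assert (Hb : Rabs (f t - f s) < m - f s) by (apply Hball, Rabs_def1; lra).
    apply Rabs_def2 in Hb; specialize (Habove t (proj1 Ht)); lra.
Qed.

Lemma continuous_flip (f : R -> R) (t : R) :
  continuous f (- t) -> continuous (fun t => f (- t)) t.
Proof.
  intros Hf; apply (continuous_comp (fun t : R => - t) f); [|assumption].
  apply (ex_derive_continuous (fun t : R => - t)); auto_derive; exact I.
Qed.

Lemma first_above (f : R -> R) (x y m : R) :
  x <= y -> (forall t, x <= t <= y -> continuous f t) -> f x < m <= f y ->
  exists t0, x < t0 <= y /\ f t0 = m /\ forall t, x <= t < t0 -> f t < m.
Proof.
  intros Hxy Hc Hm.
  destruct (last_below (fun t => - f (- t)) (- y) (- x) (- m)) as [t0 [Ht0 [Hft0 Hlt]]].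
  - lra.
  - intros t Ht; apply (continuous_opp (fun t => f (- t)) t), continuous_flip, Hc; lra.
  - rewrite !Ropp_involutive; lra.
  - exists (- t0); repeat split; try lra.
    intros t Ht. specialize (Hlt (- t)). rewrite Ropp_involutive in Hlt. lra.
Qed.

Lemma mean_value (f : R -> R) (x y : R) :
  x < y -> (forall t, x <= t <= y -> continuous f t) ->
  (forall t, x < t < y -> ex_derive f t) ->
  exists t, x < t < y /\ f y - f x = Derive f t * (y - x).
Proof.
  intros Hxy Hc Hd.
  assert (Hpr : forall t, x < t < y -> derivable_pt f t).
  { intros t Ht; apply ex_derive_Reals_0, Hd, Ht. }
  destruct (MVT f id x y Hpr (fun t _ => derivable_pt_id t) Hxy) as [t [Ht Heq]].
  - intros t Ht; apply continuity_pt_filterlim, Hc, Ht.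
  - intros t Ht; apply derivable_continuous_pt, derivable_pt_id.
  - exists t; split; [assumption|].
    rewrite derive_pt_id in Heq; unfold id in Heq.
    rewrite <- (Derive_Reals f t (Hpr t Ht)); lra.
Qed.

(** To end above [a], [f] must climb across the band [a < f < b]. The last passage through its lower
    third level and the next passage through the upper one bound an interval on which [f] stays
    inside the band, and there the mean value theorem contradicts the sign of the derivative.
    Nothing is asked of the derivative outside the band. *)
Lemma barrier (f : R -> R) (a b x y : R) :
  x <= y -> (forall t, x <= t <= y -> continuous f t) -> f x <= a < b ->
  (forall t, x < t < y -> a < f t < b -> exists l, is_derive f t l /\ l <= 0) ->
  f y <= a.
Proof.
  intros Hxy Hc [Hx Hab] Hd.
  destruct (Rle_lt_dec (f y) a) as [|Hy]; [assumption|exfalso].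
  set (m := Rmin (f y) b).
  assert (Hm : a < m /\ m <= f y /\ m <= b).
  { unfold m; repeat split; [apply Rmin_glb_lt; lra|apply Rmin_l|apply Rmin_r]. }
  destruct (last_below f x y (a + (m - a) / 3) Hxy Hc) as [x' [Hx' [Hfx' Hlo]]]; [lra|].
  destruct (first_above f x' y (a + 2 * (m - a) / 3)) as [y' [Hy' [Hfy' Hhi]]].
  - lra.
  - intros t Ht; apply Hc; lra.
  - lra.
  - assert (Hder : forall t, x' < t < y' -> exists l, is_derive f t l /\ l <= 0).
    { intros t Ht; specialize (Hlo t); specialize (Hhi t); apply Hd; lra. }
    destruct (mean_value f x' y') as [t [Ht Heq]].
    + lra.
    + intros t Ht; apply Hc; lra.
    + intros t Ht; destruct (Hder t Ht) as [l [Hl _]]; exists l; exact Hl.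
    + destruct (Hder t Ht) as [l [Hl Hle]].
      apply is_derive_unique in Hl; rewrite Hl in Heq.
      assert (l * (y' - x') <= 0) by nra.
      lra.
Qed.

Lemma nonincreasing_of_derive (f : R -> R) (x y : R) :
  x <= y -> (forall t, x <= t <= y -> continuous f t) ->
  (forall t, x < t < y -> exists l, is_derive f t l /\ l <= 0) -> f y <= f x.
Proof.
  intros Hxy Hc Hd; apply (barrier f (f x) (f x + 1) x y); try assumption; try lra.
  intros t Ht _; apply Hd, Ht.
Qed.

Lemma nondecreasing_of_derive (f : R -> R) (x y : R) :
  x <= y -> (forall t, x <= t <= y -> continuous f t) ->
  (forall t, x < t < y -> exists l, is_derive f t l /\ 0 <= l) -> f x <= f y.
Proof.
  intros Hxy Hc Hd.
  assert (- f y <= - f x); [|lra].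
  apply (nonincreasing_of_derive (fun t => - f t) x y); [assumption| |].
  - intros t Ht; apply (continuous_opp f), Hc, Ht.
  - intros t Ht; destruct (Hd t Ht) as [l [Hl Hl0]]; exists (- l); split; [|lra].
    apply (is_derive_opp f), Hl.
Qed.

Lemma decreasing_of_derive (f : R -> R) (x y : R) :
  x < y -> (forall t, x <= t <= y -> continuous f t) ->
  (forall t, x < t < y -> exists l, is_derive f t l /\ l < 0) -> f y < f x.
Proof.
  intros Hxy Hc Hd.
  destruct (mean_value f x y Hxy Hc) as [t [Ht Heq]].
  - intros t Ht; destruct (Hd t Ht) as [l [Hl _]]; exists l; exact Hl.
  - destruct (Hd t Ht) as [l [Hl Hlt]].
    apply is_derive_unique in Hl; rewrite Hl in Heq; nra.
Qed.

(** The two exceptional levels are skipped by a window between [f x] and [f y]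
    that contains neither. *)
Lemma nonincreasing_off_levels (f : R -> R) (l1 l2 x y : R) :
  x <= y -> (forall t, x <= t <= y -> continuous f t) ->
  (forall t, x < t < y -> f t <> l1 -> f t <> l2 ->
     exists l, is_derive f t l /\ l <= 0) -> f y <= f x.
Proof.
  intros Hxy Hc Hd.
  destruct (Rle_lt_dec (f y) (f x)) as [|Hlt]; [assumption|exfalso].
  assert (Hskip : forall a b l : R, a < b ->
            exists b', a < b' <= b /\ forall v, a < v < b' -> v <> l).
  { intros a b l Hab; destruct (Rlt_dec a l) as [Hal|Hal]; [destruct (Rlt_dec l b)|].
    - exists l; split; [lra|intros v Hv; lra].
    - exists b; split; [lra|intros v Hv; lra].
    - exists b; split; [lra|intros v Hv; lra]. }
  destruct (Hskip _ _ l1 Hlt) as [b1 [Hb1 Hv1]].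
  destruct (Hskip (f x) b1 l2) as [b2 [Hb2 Hv2]]; [lra|].
  assert (f y <= f x); [|lra].
  apply (barrier f (f x) b2 x y); try assumption; [lra|].
  intros t Ht Hft; apply Hd; [assumption|apply Hv1; lra|apply Hv2; lra].
Qed.

Lemma derive_at_min (f : R -> R) (x y t : R) :
  x < t < y -> ex_derive f t -> (forall s, x < s < y -> f t <= f s) -> Derive f t = 0.
Proof.
  intros Ht Hd Hmin.
  rewrite <- (Derive_Reals f t (ex_derive_Reals_0 f t Hd)).
  apply (deriv_minimum f x y); [apply Ht|apply Ht|].
  intros s Hs1 Hs2; apply Hmin; lra.
Qed.

(** The difference quotient of [g] at [y] is the reciprocal of one of [f] at [g y]; continuity of
    [g] makes the latter tend to [l]. A right inverse near [y] suffices. *)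
Lemma is_derive_inverse (f g : R -> R) (y l : R) :
  is_derive f (g y) l -> l <> 0 -> continuous g y ->
  locally y (fun z => f (g z) = z) -> is_derive g y (/ l).
Proof.
  intros Hf Hl Hg Hfg.
  assert (Hfgy : f (g y) = y) by (apply (locally_singleton y _ Hfg)).
  apply is_derive_Reals; apply is_derive_Reals in Hf.
  intros eps Heps.
  (* The first bound keeps the quotient [m] of [f] at distance from 0, [|m| >= |l| / 2]; the second
     then gives [|1/m - 1/l| = |m - l| / (|m| |l|) <= eps / 2]. *)
  set (e1 := Rmin (Rabs l / 2) (eps * (Rabs l * Rabs l) / 4)).
  assert (HL : 0 < Rabs l) by (apply Rabs_pos_lt, Hl).
  assert (He1 : 0 < e1 /\ e1 <= Rabs l / 2 /\ e1 <= eps * (Rabs l * Rabs l) / 4).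
  { unfold e1; repeat split; [|apply Rmin_l|apply Rmin_r].
    apply Rmin_glb_lt; [lra|].
    assert (0 < eps * (Rabs l * Rabs l)) by (repeat apply Rmult_lt_0_compat; lra). lra. }
  destruct (Hf e1 (proj1 He1)) as [d Hd].
  destruct (proj1 (continuous_eps g y) Hg d (cond_pos d)) as [d1 [Hd1 Hgd]].
  destruct Hfg as [d2 Hd2].
  assert (Hd3 : 0 < Rmin d1 d2) by (apply Rmin_glb_lt; [lra|apply cond_pos]).
  exists (mkposreal _ Hd3); simpl; intros k Hk Hkd.
  assert (Hk1 : Rabs k < d1) by (eapply Rlt_le_trans; [exact Hkd|apply Rmin_l]).
  assert (Hk2 : Rabs k < d2) by (eapply Rlt_le_trans; [exact Hkd|apply Rmin_r]).
  assert (Hyk : f (g (y + k)) = y + k).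
  { apply Hd2; unfold ball; simpl; unfold AbsRing_ball, abs, minus, plus, opp; simpl.
    replace (y + k + - y) with k by ring; exact Hk2. }
  assert (Hgk : Rabs (g (y + k) - g y) < d).
  { apply Hgd; replace (y + k - y) with k by ring; exact Hk1. }
  set (s := g (y + k) - g y) in *.
  assert (Hs0 : s <> 0).
  { intros Hs; apply Hk; unfold s in Hs.
    assert (Hgg : g (y + k) = g y) by lra.
    rewrite Hgg, Hfgy in Hyk; lra. }
  specialize (Hd s Hs0 Hgk).
  replace (g y + s) with (g (y + k)) in Hd by (unfold s; ring).
  rewrite Hyk, Hfgy in Hd.
  replace (y + k - y) with k in Hd by ring.
  set (m := k / s) in *.
  assert (Hm : Rabs l / 2 <= Rabs m).
  { pose proof (Rabs_triang_inv l (l - m)) as Htri.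
    replace (l - (l - m)) with m in Htri by ring.
    rewrite (Rabs_minus_sym l m) in Htri. lra. }
  assert (Hm0 : m <> 0) by (intros E; rewrite E, Rabs_R0 in Hm; lra).
  replace (s / k - / l) with (- ((m - l) * / (m * l))).
  2:{ unfold m; field; repeat split; try assumption. }
  rewrite Rabs_Ropp, Rabs_mult, Rabs_inv, Rabs_mult.
  assert (Hml : Rabs l * Rabs l / 2 <= Rabs m * Rabs l) by nra.
  apply (Rmult_lt_reg_r (Rabs m * Rabs l)); [nra|].
  rewrite Rmult_assoc, Rinv_l by nra.
  nra.
Qed.

(** * Powers of the positive part *)

(** [Rpower] takes the value 1 at nonpositive bases. With 0 there instead, a power of positive
    exponent is continuous and nondecreasing on the whole line, so the equations can be stated
    before the unknown is known to be nonnegative. *)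
Definition pos_pow (x e : R) : R := if Rlt_dec 0 x then Rpower x e else 0.

Lemma pos_powE (x e : R) : 0 < x -> pos_pow x e = Rpower x e.
Proof. intros Hx; unfold pos_pow; destruct (Rlt_dec 0 x); [reflexivity|lra]. Qed.

Lemma pos_pow_npos (x e : R) : x <= 0 -> pos_pow x e = 0.
Proof. intros Hx; unfold pos_pow; destruct (Rlt_dec 0 x); [lra|reflexivity]. Qed.

Lemma Rpower_pos (x e : R) : 0 < Rpower x e.
Proof. apply exp_pos. Qed.

Lemma pos_pow_gt0 (x e : R) : 0 < x -> 0 < pos_pow x e.
Proof. intros Hx; rewrite pos_powE by assumption; apply Rpower_pos. Qed.

Lemma pos_pow_ge0 (x e : R) : 0 <= pos_pow x e.
Proof.
  destruct (Rlt_le_dec 0 x).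
  - left; apply pos_pow_gt0; assumption.
  - rewrite pos_pow_npos by assumption; lra.
Qed.

Lemma pos_pow_lt (x y e : R) : 0 < e -> 0 <= x < y -> pos_pow x e < pos_pow y e.
Proof.
  intros He [Hx Hxy]; destruct (Rle_lt_or_eq_dec 0 x Hx) as [Hx0|<-].
  - rewrite !pos_powE by lra; unfold Rpower; apply exp_increasing.
    apply Rmult_lt_compat_l; [assumption|apply ln_increasing; assumption].
  - rewrite (pos_pow_npos 0) by lra; apply pos_pow_gt0; lra.
Qed.

Lemma pos_pow_le (x y e : R) : 0 < e -> x <= y -> pos_pow x e <= pos_pow y e.
Proof.
  intros He [Hxy| ->]; [|apply Rle_refl].
  destruct (Rle_lt_dec 0 x).
  - left; apply pos_pow_lt; lra.
  - rewrite (pos_pow_npos x) by lra; apply pos_pow_ge0.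
Qed.

Lemma pos_powM (x a b : R) : pos_pow (pos_pow x a) b = pos_pow x (a * b).
Proof.
  destruct (Rlt_le_dec 0 x) as [Hx|Hx].
  - rewrite (pos_powE _ b) by (apply pos_pow_gt0; assumption).
    rewrite !pos_powE by assumption; apply Rpower_mult.
  - rewrite !(pos_pow_npos x), pos_pow_npos by lra; reflexivity.
Qed.

Lemma pos_pow_1 (x : R) : 0 <= x -> pos_pow x 1 = x.
Proof.
  intros [Hx| <-]; [rewrite pos_powE, Rpower_1 by assumption; reflexivity|].
  apply pos_pow_npos; lra.
Qed.

Lemma le_Rpower_unit (s e : R) : 0 < s <= 1 -> 0 < e <= 1 -> s <= Rpower s e.
Proof.
  intros Hs He; rewrite <- (Rpower_1 s) at 1 by apply Hs.
  unfold Rpower; destruct (Rle_lt_or_eq_dec s 1 (proj2 Hs)) as [Hs1| ->].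
  - assert (ln s < 0) by (rewrite <- ln_1; apply ln_increasing; lra).
    assert (H1 : 1 * ln s <= e * ln s) by nra.
    destruct H1 as [H1|H1]; [left; apply exp_increasing, H1|rewrite H1; lra].
  - rewrite ln_1, !Rmult_0_r; lra.
Qed.

(** The fractions [x / (x + y)] and [y / (x + y)] sum to 1, and each is at most its own power
    [e]. *)
Lemma pos_pow_subadd (x y e : R) : 0 < e <= 1 -> 0 <= x -> 0 <= y ->
  pos_pow (x + y) e <= pos_pow x e + pos_pow y e.
Proof.
  intros He [Hx| <-] [Hy| <-].
  - rewrite !pos_powE by lra.
    assert (Hfrac : forall u v, 0 < u -> 0 < v ->
              u / (u + v) * Rpower (u + v) e <= Rpower u e).
    { intros u v Hu Hv.
      assert (Hq : 0 < u / (u + v)) by (apply Rdiv_lt_0_compat; lra).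
      replace (Rpower u e) with (Rpower (u / (u + v)) e * Rpower (u + v) e).
      2:{ rewrite Rpower_mult_distr by lra; f_equal.
          replace (u / (u + v) * (u + v)) with u by (field; lra). reflexivity. }
      apply Rmult_le_compat_r; [left; apply Rpower_pos|].
      apply le_Rpower_unit; [split; [assumption|]|assumption].
      apply (Rmult_le_reg_r (u + v)); [lra|].
      replace (u / (u + v) * (u + v)) with u by (field; lra); lra. }
    pose proof (Hfrac x y Hx Hy) as H1; pose proof (Hfrac y x Hy Hx) as H2.
    rewrite (Rplus_comm y x) in H2.
    replace (Rpower (x + y) e)
      with (x / (x + y) * Rpower (x + y) e + y / (x + y) * Rpower (x + y) e)
      by (field; lra).
    lra.
  - rewrite Rplus_0_r, (pos_pow_npos 0) by lra; lra.
  - rewrite Rplus_0_l, (pos_pow_npos 0) by lra; lra.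
  - rewrite Rplus_0_l, (pos_pow_npos 0) by lra; lra.
Qed.

(** Subadditivity applied to the larger argument as the smaller one plus the difference. This
    modulus of continuity stands in for a Lipschitz bound below. *)
Lemma pos_pow_holder (x y e : R) : 0 < e <= 1 ->
  Rabs (pos_pow x e - pos_pow y e) <= pos_pow (Rabs (x - y)) e.
Proof.
  intros He.
  assert (Hmain : forall x y, x <= y -> pos_pow y e - pos_pow x e <= pos_pow (y - x) e).
  { clear x y; intros x y Hxy; destruct (Rle_lt_dec 0 x) as [Hx|Hx].
    - pose proof (pos_pow_subadd x (y - x) e He Hx) as Hs.
      replace (x + (y - x)) with y in Hs by ring; lra.
    - rewrite (pos_pow_npos x) by lra.
      assert (pos_pow y e <= pos_pow (y - x) e) by (apply pos_pow_le; lra); lra. }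
  destruct (Rle_dec x y) as [Hxy|Hxy].
  - assert (pos_pow x e <= pos_pow y e) by (apply pos_pow_le; lra).
    rewrite Rabs_left1, (Rabs_left1 (x - y)) by lra.
    specialize (Hmain x y Hxy); replace (- (x - y)) with (y - x) by ring; lra.
  - assert (pos_pow y e <= pos_pow x e) by (apply pos_pow_le; lra).
    rewrite Rabs_pos_eq, (Rabs_pos_eq (x - y)) by lra.
    apply Hmain; lra.
Qed.

Lemma pos_pow_small (e eps : R) : 0 < e -> 0 < eps ->
  exists d, 0 < d /\ forall x, x <= d -> pos_pow x e <= eps.
Proof.
  intros He Heps; exists (pos_pow eps (1 / e)).
  split; [apply pos_pow_gt0; assumption|].
  intros x Hx; apply (Rle_trans _ (pos_pow (pos_pow eps (1 / e)) e)).
  - apply pos_pow_le; assumption.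
  - rewrite pos_powM; replace (1 / e * e) with 1 by (field; lra).
    rewrite pos_pow_1; lra.
Qed.

Lemma is_derive_Rpower (x e : R) : 0 < x ->
  is_derive (fun x => Rpower x e) x (e * Rpower x (e - 1)).
Proof. intros Hx; apply is_derive_Reals, derivable_pt_lim_power, Hx. Qed.

Lemma locally_gt (x m : R) : m < x -> locally x (fun y => m < y).
Proof. intros H; apply (open_gt m), H. Qed.

Lemma locally_lt (x m : R) : x < m -> locally x (fun y => y < m).
Proof. intros H; apply (open_lt m), H. Qed.

Lemma is_derive_pos_pow (x e : R) : 0 < x ->
  is_derive (fun x => pos_pow x e) x (e * Rpower x (e - 1)).
Proof.
  intros Hx; apply (is_derive_ext_loc (fun x => Rpower x e)).
  - apply (filter_imp (fun y => 0 < y)); [|apply locally_gt, Hx].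
    intros y Hy; symmetry; apply pos_powE, Hy.
  - apply is_derive_Rpower, Hx.
Qed.

Lemma continuous_pos_pow (x e : R) : 0 < e -> continuous (fun x => pos_pow x e) x.
Proof.
  intros He; destruct (Rlt_le_dec 0 x) as [Hx|Hx].
  - apply (ex_derive_continuous (fun x => pos_pow x e)).
    eexists; apply is_derive_pos_pow, Hx.
  - apply continuous_eps; intros eps Heps.
    destruct (pos_pow_small e (eps / 2) He) as [d [Hd Hsmall]]; [lra|].
    exists d; split; [assumption|]; intros y Hy.
    rewrite (pos_pow_npos x) by assumption; rewrite Rminus_0_r.
    rewrite Rabs_pos_eq by apply pos_pow_ge0.
    apply Rabs_def2 in Hy.
    assert (pos_pow y e <= eps / 2) by (apply Hsmall; lra); lra.
Qed.

(** * An ordinary differential equation with a nonincreasing right-hand side *)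

Lemma is_derive_eq (f : R -> R) (x l l' : R) : is_derive f x l -> l = l' -> is_derive f x l'.
Proof. intros H <-; exact H. Qed.

Lemma continuous_of_is_derive (f : R -> R) (x l : R) : is_derive f x l -> continuous f x.
Proof. intros H; apply (ex_derive_continuous f); exists l; exact H. Qed.

(** Continuity is asked only inside an open interval, since the integrands of interest may be
    singular at its ends. *)
Lemma is_derive_primitive_itv (f : R -> R) (lo hi a t : R) :
  (forall s, lo < s < hi -> continuous f s) -> lo < a < hi -> lo < t < hi ->
  is_derive (fun t => RInt f a t) t (f t).
Proof.
  intros Hf Ha Ht; apply (is_derive_RInt f (fun t => RInt f a t) a t); [|apply Hf, Ht].
  apply (filter_imp (fun y => lo < y /\ y < hi)).
  - intros y Hy; apply (RInt_correct (V := R_CompleteNormedModule) f a y),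
      (ex_RInt_continuous (V := R_CompleteNormedModule) f a y).
    intros s Hs; apply Hf; split.
    + apply (Rlt_le_trans _ (Rmin a y)); [apply Rmin_glb_lt|]; lra.
    + apply (Rle_lt_trans _ (Rmax a y)); [|apply Rmax_lub_lt]; lra.
  - apply filter_and; [apply (open_gt lo)|apply (open_lt hi)]; apply Ht.
Qed.

Lemma is_derive_primitive (f : R -> R) (a t : R) :
  (forall s, continuous f s) -> is_derive (fun t => RInt f a t) t (f t).
Proof.
  intros Hf; apply (is_derive_primitive_itv f (Rmin a t - 1) (Rmax a t + 1)).
  - intros s _; apply Hf.
  - pose proof (Rmin_l a t); pose proof (Rmax_l a t); lra.
  - pose proof (Rmin_r a t); pose proof (Rmax_r a t); lra.
Qed.

Lemma RInt_same (f : R -> R) (a : R) : RInt f a a = 0.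
Proof. exact (RInt_point a f). Qed.

Lemma continuous_Rmult (f g : R -> R) (x : R) :
  continuous f x -> continuous g x -> continuous (fun t => f t * g t) x.
Proof. intros Hf Hg; apply (continuous_mult f g x Hf Hg). Qed.

Lemma continuous_Rminus (f g : R -> R) (x : R) :
  continuous f x -> continuous g x -> continuous (fun t => f t - g t) x.
Proof. intros Hf Hg; apply (continuous_minus f g x Hf Hg). Qed.

Lemma continuous_Rplus (f g : R -> R) (x : R) :
  continuous f x -> continuous g x -> continuous (fun t => f t + g t) x.
Proof. intros Hf Hg; apply (continuous_plus f g x Hf Hg). Qed.

Lemma lipschitz_continuous (f : R -> R) (M x : R) :
  (forall y, Rabs (f y - f x) <= M * Rabs (y - x)) -> continuous f x.
Proof.
  intros Hf; apply continuous_eps; intros eps Heps.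
  pose proof (Rabs_pos M) as HM.
  exists (eps / (Rabs M + 1)); split; [apply Rdiv_lt_0_compat; lra|].
  intros y Hy; apply (Rle_lt_trans _ _ _ (Hf y)).
  apply (Rle_lt_trans _ (Rabs M * Rabs (y - x))).
  - apply Rmult_le_compat_r; [apply Rabs_pos|apply Rle_abs].
  - assert (Rabs (y - x) * (Rabs M + 1) < eps).
    { apply (Rmult_lt_compat_r (Rabs M + 1)) in Hy; [|lra].
      replace (eps / (Rabs M + 1) * (Rabs M + 1)) with eps in Hy by (field; lra); lra. }
    pose proof (Rabs_pos (y - x)); nra.
Qed.

Lemma Rmax_lipschitz (a x y : R) : Rabs (Rmax a x - Rmax a y) <= Rabs (x - y).
Proof.
  unfold Rmax; destruct (Rle_dec a x), (Rle_dec a y); unfold Rabs;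
    repeat destruct Rcase_abs; lra.
Qed.

Lemma Rmin_lipschitz (a x y : R) : Rabs (Rmin a x - Rmin a y) <= Rabs (x - y).
Proof.
  unfold Rmin; destruct (Rle_dec a x), (Rle_dec a y); unfold Rabs;
    repeat destruct Rcase_abs; lra.
Qed.

Definition clamp (t : R) : R := Rmax 0 (Rmin 1 t).

Lemma clamp_range (t : R) : 0 <= clamp t <= 1.
Proof.
  unfold clamp; split; [apply Rmax_l|apply Rmax_lub; [lra|apply Rmin_l]].
Qed.

Lemma clamp_id (t : R) : 0 <= t <= 1 -> clamp t = t.
Proof. intros Ht; unfold clamp; rewrite Rmin_right, Rmax_right; lra. Qed.

Lemma clamp_lipschitz (x y : R) : Rabs (clamp x - clamp y) <= Rabs (x - y).
Proof. eapply Rle_trans; [apply Rmax_lipschitz|apply Rmin_lipschitz]. Qed.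

Lemma continuous_clamp (x : R) : continuous clamp x.
Proof.
  apply (lipschitz_continuous clamp 1); intros y; rewrite Rmult_1_l; apply clamp_lipschitz.
Qed.

(** The right-hand side is nonincreasing in the unknown, hence the flow does not
    amplify perturbations. *)
Lemma ode_gap (K P W1 W2 r1 r2 : R -> R) (a E t0 t1 : R) :
  0 < a -> 0 <= E -> t0 <= t1 -> (forall t, t0 < t < t1 -> 0 <= K t) ->
  (forall t, t0 <= t <= t1 -> continuous W1 t) ->
  (forall t, t0 <= t <= t1 -> continuous W2 t) ->
  (forall t, t0 < t < t1 -> is_derive W1 t (K t * pos_pow (P t - W1 t) a + r1 t)) ->
  (forall t, t0 < t < t1 -> is_derive W2 t (K t * pos_pow (P t - W2 t) a + r2 t)) ->
  (forall t, t0 < t < t1 -> r1 t - r2 t <= E) ->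
  W1 t0 <= W2 t0 -> W1 t1 - W2 t1 <= E * (t1 - t0).
Proof.
  intros Ha HE Ht HK Hc1 Hc2 Hd1 Hd2 Hr H0.
  assert (W1 t1 - W2 t1 - E * (t1 - t0) <= 0); [|lra].
  assert (Haff : forall t, is_derive (fun t => E * (t - t0)) t E).
  { intros t; auto_derive; [exact I|ring]. }
  apply (barrier (fun t => W1 t - W2 t - E * (t - t0)) 0 1 t0 t1); try lra.
  - intros t Ht'; apply continuous_Rminus.
    + apply continuous_Rminus; [apply Hc1|apply Hc2]; assumption.
    + eapply continuous_of_is_derive, Haff.
  - intros t Ht' Hpos; eexists; split.
    + apply (is_derive_minus (fun t => W1 t - W2 t) (fun t => E * (t - t0))); [|apply Haff].
      apply (is_derive_minus W1 W2); [apply Hd1, Ht'|apply Hd2, Ht'].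
    + unfold minus, plus, opp; simpl.
      assert (W2 t <= W1 t) by (assert (0 <= E * (t - t0)) by (apply Rmult_le_pos; lra); lra).
      assert (pos_pow (P t - W1 t) a <= pos_pow (P t - W2 t) a) by (apply pos_pow_le; lra).
      specialize (HK t Ht'); specialize (Hr t Ht').
      assert (K t * pos_pow (P t - W1 t) a <= K t * pos_pow (P t - W2 t) a)
        by (apply Rmult_le_compat_l; assumption).
      lra.
Qed.

(** Delayed approximations of [W' = K (P - W)_+^a], [W 0 = 0]: the [k]-th iterate is
    stationary on [[0, k d]]. *)
Fixpoint tonelli (K P : R -> R) (a d : R) (k : nat) (t : R) : R :=
  match k with
  | O => 0
  | S k => RInt (fun s => K s * pos_pow (P s - tonelli K P a d k (Rmax 0 (s - d))) a) 0 t
  end.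

Lemma continuous_rhs (K P V : R -> R) (a t : R) : 0 < a ->
  continuous K t -> continuous P t -> continuous V t ->
  continuous (fun s => K s * pos_pow (P s - V s) a) t.
Proof.
  intros Ha HK HP HV; apply continuous_Rmult; [assumption|].
  apply (continuous_comp (fun s => P s - V s) (fun x => pos_pow x a)).
  - apply continuous_Rminus; assumption.
  - apply continuous_pos_pow, Ha.
Qed.

Lemma continuous_delay (d t : R) : continuous (fun s => Rmax 0 (s - d)) t.
Proof.
  apply (lipschitz_continuous _ 1); intros y; rewrite Rmult_1_l.
  eapply Rle_trans; [apply Rmax_lipschitz|].
  apply Req_le; f_equal; ring.
Qed.

Lemma tonelli_continuous_derive (K P : R -> R) (a d : R) (k : nat) : 0 < a ->
  (forall t, continuous K t) -> (forall t, continuous P t) ->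
  (forall t, continuous (tonelli K P a d k) t) /\
  (forall t, is_derive (tonelli K P a d (S k)) t
     (K t * pos_pow (P t - tonelli K P a d k (Rmax 0 (t - d))) a)).
Proof.
  intros Ha HK HP.
  assert (Hstep : forall k, (forall t, continuous (tonelli K P a d k) t) ->
    forall t, is_derive (tonelli K P a d (S k)) t
     (K t * pos_pow (P t - tonelli K P a d k (Rmax 0 (t - d))) a)).
  { intros j Hj t; simpl.
    apply (is_derive_primitive
      (fun s => K s * pos_pow (P s - tonelli K P a d j (Rmax 0 (s - d))) a)).
    intros s; apply (continuous_rhs K P (fun s => tonelli K P a d j (Rmax 0 (s - d))));
      [assumption|apply HK|apply HP|].
    apply (continuous_comp (fun s => Rmax 0 (s - d))); [apply continuous_delay|apply Hj]. }
  assert (Hc : forall t, continuous (tonelli K P a d k) t).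
  { induction k as [|k IH]; intros t.
    - apply continuous_const.
    - eapply continuous_of_is_derive, Hstep, IH. }
  split; [exact Hc|apply Hstep, Hc].
Qed.

(** On [[0, (k + 1) d]] the delayed argument lies in [[0, k d]], where the two previous iterates
    already agree. *)
Lemma tonelli_stable (K P : R -> R) (a d : R) (k : nat) (t : R) : 0 < d ->
  0 <= t <= INR k * d -> tonelli K P a d (S k) t = tonelli K P a d k t.
Proof.
  intros Hd; revert t; induction k as [|k IH]; intros t Ht.
  - simpl in Ht; replace t with 0 by lra; simpl; apply RInt_same.
  - set (j := S k); change (tonelli K P a d (S j) t) with
      (RInt (fun s => K s * pos_pow (P s - tonelli K P a d j (Rmax 0 (s - d))) a) 0 t).
    unfold j; change (tonelli K P a d (S k) t) with
      (RInt (fun s => K s * pos_pow (P s - tonelli K P a d k (Rmax 0 (s - d))) a) 0 t).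
    apply RInt_ext; intros s Hs.
    rewrite Rmin_left, Rmax_right in Hs by lra.
    rewrite IH; [reflexivity|].
    rewrite S_INR in Ht; pose proof (pos_INR k).
    split; [apply Rmax_l|apply Rmax_lub; [apply Rmult_le_pos|]; lra].
Qed.

(** The delay is cut off at 0 and the iterates are nonnegative on [[0, +oo)], so the integrand lies
    between 0 and [Kb * pos_pow Pb a]. The resulting Lipschitz constant depends neither on the delay
    nor on the number of iterations. *)
Lemma tonelli_increment (K P : R -> R) (a d Kb Pb : R) (k : nat) : 0 < a ->
  (forall t, continuous K t) -> (forall t, continuous P t) ->
  (forall t, 0 <= K t <= Kb) -> (forall t, P t <= Pb) ->
  forall s t, s <= t ->
  0 <= tonelli K P a d k t - tonelli K P a d k s <= Kb * pos_pow Pb a * (t - s).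
Proof.
  intros Ha HK HP HKb HPb.
  assert (HM : 0 <= Kb * pos_pow Pb a).
  { apply Rmult_le_pos; [destruct (HKb 0); lra|apply pos_pow_ge0]. }
  induction k as [|k IH]; intros s t Hst.
  - simpl; split; [lra|]; rewrite Rminus_diag; apply Rmult_le_pos; lra.
  - destruct (tonelli_continuous_derive K P a d k Ha HK HP) as [_ Hder].
    assert (Hw : forall x, 0 <= x -> 0 <= tonelli K P a d k x).
    { intros x Hx; destruct (IH 0 x Hx) as [H0 _].
      assert (tonelli K P a d k 0 = 0); [|lra].
      destruct k; simpl; [reflexivity|apply RInt_same]. }
    assert (Hb : forall x, 0 <= K x * pos_pow (P x - tonelli K P a d k (Rmax 0 (x - d))) a
                           <= Kb * pos_pow Pb a).
    { intros x; pose proof (HKb x); split.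
      - apply Rmult_le_pos; [lra|apply pos_pow_ge0].
      - apply Rmult_le_compat; [lra|apply pos_pow_ge0|lra|].
        apply pos_pow_le; [assumption|].
        specialize (HPb x); specialize (Hw _ (Rmax_l 0 (x - d))); lra. }
    split.
    + assert (tonelli K P a d (S k) s <= tonelli K P a d (S k) t); [|lra].
      apply nondecreasing_of_derive; [assumption| |].
      * intros x _; eapply continuous_of_is_derive, Hder.
      * intros x _; eexists; split; [apply Hder|apply Hb].
    + set (M := Kb * pos_pow Pb a) in *.
      assert (Haff : forall x, is_derive (fun x => M * x) x M).
      { intros x; auto_derive; [exact I|ring]. }
      assert (tonelli K P a d (S k) t - M * t <= tonelli K P a d (S k) s - M * s); [|lra].
      assert (Hder' : forall x, is_derive (fun x => tonelli K P a d (S k) x - M * x) x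
        (K x * pos_pow (P x - tonelli K P a d k (Rmax 0 (x - d))) a - M)).
      { intros x; apply (is_derive_minus (tonelli K P a d (S k)) (fun x => M * x));
          [apply Hder|apply Haff]. }
      apply (nonincreasing_of_derive (fun x => tonelli K P a d (S k) x - M * x));
        [assumption| |].
      * intros x _; eapply continuous_of_is_derive, Hder'.
      * intros x _; eexists; split; [apply Hder'|].
        specialize (Hb x); lra.
Qed.

Lemma eventually_inv_INR_le (M eps : R) : 0 <= M -> 0 < eps ->
  exists N, forall n, (N <= n)%nat -> M * / INR (S n) <= eps.
Proof.
  intros HM Heps; destruct (INR_unbounded (M / eps)) as [N HN].
  exists N; intros n Hn.
  assert (HNn : INR N <= INR (S n)) by (apply le_INR; lia).
  assert (Hpos : 0 < INR (S n)) by (apply lt_0_INR; lia).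
  apply (Rmult_le_reg_r (INR (S n))); [assumption|].
  rewrite Rmult_assoc, Rinv_l, Rmult_1_r by lra.
  assert (M < eps * INR N).
  { apply (Rmult_lt_compat_l eps) in HN; [|assumption].
    replace (eps * (M / eps)) with M in HN by (field; lra); lra. }
  nra.
Qed.

(** An approximation with delay [d] solves the equation up to an error of order [d^a], by the
    Lipschitz bound on the iterate and the Hölder bound on the power. By [ode_gap], two
    approximations differ by at most the sum of their errors, so they form a uniform Cauchy sequence
    and no compactness argument is needed. *)
Theorem ode_exists (K P : R -> R) (a Kb Pb : R) : 0 < a <= 1 ->
  (forall t, continuous K t) -> (forall t, continuous P t) ->
  (forall t, 0 <= K t <= Kb) -> (forall t, P t <= Pb) ->
  exists W, W 0 = 0 /\
    forall t, 0 <= t <= 1 -> is_derive W t (K t * pos_pow (P t - W t) a).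
Proof.
  intros Ha HK HP HKb HPb.
  set (M := Kb * pos_pow Pb a).
  assert (HKb0 : 0 <= Kb) by (destruct (HKb 0); lra).
  assert (HM : 0 <= M) by (apply Rmult_le_pos; [lra|apply pos_pow_ge0]).
  set (dl := fun n => / INR (S n)).
  assert (Hdl : forall n, 0 < dl n) by (intros n; apply Rinv_0_lt_compat, lt_0_INR; lia).
  (* The delay is [1 / (n + 1)]: for [t <= 1] the delayed argument is at most [n / (n + 1)], where
     iterates [n] and [n + 1] coincide. Hence [Wn n] solves the delayed equation exactly on
     [[0, 1]]. *)
  set (Wn := fun n => tonelli K P a (dl n) (S n)).
  assert (Hinc : forall n s t, s <= t -> 0 <= Wn n t - Wn n s <= M * (t - s)).
  { intros n; apply tonelli_increment; try assumption; lra. }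
  assert (Hlip : forall n s t, Rabs (Wn n s - Wn n t) <= M * Rabs (s - t)).
  { intros n s t; destruct (Rle_lt_dec s t) as [Hst|Hst].
    - pose proof (Hinc n s t Hst).
      rewrite (Rabs_left1 (Wn n s - Wn n t)), (Rabs_left1 (s - t)) by lra; lra.
    - pose proof (Hinc n t s (Rlt_le _ _ Hst)).
      rewrite !Rabs_pos_eq by lra; lra. }
  assert (Hcont : forall n t, continuous (Wn n) t).
  { intros n t; apply (lipschitz_continuous _ M); intros y; apply Hlip. }
  assert (Hder : forall n t, 0 <= t <= 1 -> is_derive (Wn n) t
            (K t * pos_pow (P t - Wn n (Rmax 0 (t - dl n))) a)).
  { intros n t Ht.
    destruct (tonelli_continuous_derive K P a (dl n) n (proj1 Ha) HK HP) as [_ Hd].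
    eapply is_derive_eq; [apply Hd|]; do 3 f_equal.
    symmetry; apply tonelli_stable; [apply Hdl|].
    split; [apply Rmax_l|].
    assert (INR (S n) * dl n = 1).
    { unfold dl; field; apply not_0_INR; lia. }
    rewrite S_INR in H; pose proof (Hdl n); pose proof (pos_INR n).
    apply Rmax_lub; [apply Rmult_le_pos|]; lra. }
  assert (H0 : forall n, Wn n 0 = 0) by (intros n; apply RInt_same).
  (* Bound for the change of the right-hand side when the delayed value of [Wn n] is replaced by the
     current one. *)
  set (er := fun n => Kb * pos_pow (M * dl n) a).
  assert (Her0 : forall n, 0 <= er n).
  { intros n; apply Rmult_le_pos; [assumption|apply pos_pow_ge0]. }
  assert (Hrhs : forall t x y e, Rabs (x - y) <= e ->
            Rabs (K t * pos_pow (P t - x) a - K t * pos_pow (P t - y) a) <= Kb * pos_pow e a).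
  { intros t x y e Hxy.
    rewrite <- Rmult_minus_distr_l, Rabs_mult, (Rabs_pos_eq (K t)) by apply HKb.
    apply Rmult_le_compat; [apply HKb|apply Rabs_pos|apply HKb|].
    eapply Rle_trans; [apply pos_pow_holder, Ha|].
    apply pos_pow_le; [apply Ha|].
    replace (P t - x - (P t - y)) with (- (x - y)) by ring; rewrite Rabs_Ropp; exact Hxy. }
  assert (Hdelay : forall n t, 0 <= t -> Rabs (Wn n (Rmax 0 (t - dl n)) - Wn n t) <= M * dl n).
  { intros n t Ht; eapply Rle_trans; [apply Hlip|].
    apply Rmult_le_compat_l; [assumption|].
    pose proof (Hdl n); unfold Rmax; destruct (Rle_dec 0 (t - dl n)); unfold Rabs;
      destruct Rcase_abs; lra. }
  assert (Hgap : forall n m t, 0 <= t <= 1 -> Wn n t - Wn m t <= er n + er m).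
  { intros n m t Ht.
    set (r := fun n t => K t * pos_pow (P t - Wn n (Rmax 0 (t - dl n))) a
                         - K t * pos_pow (P t - Wn n t) a).
    assert (Hr : forall n s, 0 <= s -> Rabs (r n s) <= er n).
    { intros j s Hs; apply Hrhs, Hdelay, Hs. }
    pose proof (Her0 n); pose proof (Her0 m).
    apply (Rle_trans _ ((er n + er m) * (t - 0))); [|nra].
    apply (ode_gap K P (Wn n) (Wn m) (r n) (r m) a); try (apply Ha); try lra.
    - intros s _; apply HKb.
    - intros s _; apply Hcont.
    - intros s _; apply Hcont.
    - intros s Hs; eapply is_derive_eq; [apply Hder; lra|unfold r; ring].
    - intros s Hs; eapply is_derive_eq; [apply Hder; lra|unfold r; ring].
    - intros s Hs; assert (Hs0 : 0 <= s) by lra.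
      pose proof (proj1 (Rabs_le_between _ _) (Hr n s Hs0)).
      pose proof (proj1 (Rabs_le_between _ _) (Hr m s Hs0)); lra.
    - rewrite !H0; lra. }
  assert (Hsmall : forall eps, 0 < eps -> exists N, forall n, (N <= n)%nat ->
            M * dl n <= eps /\ er n <= eps).
  { intros eps Heps.
    destruct (pos_pow_small a (eps / (Kb + 1)) (proj1 Ha)) as [d [Hd Hpd]];
      [apply Rdiv_lt_0_compat; lra|].
    destruct (eventually_inv_INR_le M (Rmin d eps) HM) as [N HN];
      [apply Rmin_glb_lt; assumption|].
    exists N; intros n Hn; specialize (HN n Hn); split.
    - eapply Rle_trans; [exact HN|apply Rmin_r].
    - specialize (Hpd (M * dl n) (Rle_trans _ _ _ HN (Rmin_l _ _))).
      unfold er; pose proof (pos_pow_ge0 (M * dl n) a).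
      apply (Rle_trans _ ((Kb + 1) * pos_pow (M * dl n) a)); [lra|].
      apply (Rmult_le_compat_l (Kb + 1)) in Hpd; [|lra].
      replace ((Kb + 1) * (eps / (Kb + 1))) with eps in Hpd by (field; lra); exact Hpd. }
  (* The Cauchy estimate holds on [[0, 1]] only; evaluating at [clamp t] gives a limit for every
     [t], hence an integrand continuous on the whole line. *)
  set (L := fun t => real (Lim_seq (fun n => Wn n (clamp t)))).
  assert (HL : forall t, is_lim_seq (fun n => Wn n (clamp t)) (L t)).
  { intros t; apply (Lim_seq_correct' (fun n => Wn n (clamp t))).
    apply ex_lim_seq_cauchy_corr; intros eps.
    destruct (Hsmall (eps / 4)) as [N HN]; [pose proof (cond_pos eps); lra|].
    exists N; intros n m Hn Hm.
    pose proof (Hgap n m _ (clamp_range t)); pose proof (Hgap m n _ (clamp_range t)).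
    pose proof (proj2 (HN n Hn)); pose proof (proj2 (HN m Hm)); pose proof (cond_pos eps).
    apply Rabs_def1; lra. }
  assert (Happ : forall t s eps, 0 < eps -> exists m, er m <= eps /\
            Rabs (Wn m (clamp t) - L t) < eps /\ Rabs (Wn m (clamp s) - L s) < eps).
  { intros t s eps Heps; destruct (Hsmall eps Heps) as [N HN].
    destruct (proj2 (is_lim_seq_spec _ _) (HL t) (mkposreal eps Heps)) as [N1 HN1].
    destruct (proj2 (is_lim_seq_spec _ _) (HL s) (mkposreal eps Heps)) as [N2 HN2].
    exists (N + N1 + N2)%nat; split; [apply HN; lia|split; [apply HN1|apply HN2]; lia]. }
  assert (HWL : forall n t, 0 <= t <= 1 -> Rabs (Wn n t - L t) <= er n).
  { intros n t Ht; apply le_epsilon; intros eps Heps.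
    destruct (Happ t t (eps / 2)) as [m [Hm [Hb _]]]; [lra|].
    rewrite clamp_id in Hb by assumption; apply Rabs_def2 in Hb.
    pose proof (Hgap n m t Ht); pose proof (Hgap m n t Ht).
    apply Rabs_le; lra. }
  assert (HLc : forall t, continuous L t).
  { intros t; apply (lipschitz_continuous _ M); intros s; apply le_epsilon; intros eps Heps.
    destruct (Happ t s (eps / 2)) as [m [_ [Hb1 Hb2]]]; [lra|].
    apply Rabs_def2 in Hb1; apply Rabs_def2 in Hb2.
    assert (Hb3 : Rabs (Wn m (clamp s) - Wn m (clamp t)) <= M * Rabs (s - t)).
    { eapply Rle_trans; [apply Hlip|].
      apply Rmult_le_compat_l; [assumption|apply clamp_lipschitz]. }
    apply Rabs_le_between in Hb3; apply Rabs_le; lra. }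
  (* [W] is differentiable by construction, with [L] in its right-hand side. It solves the equation
     once [W = L] on [[0, 1]], which holds because both are uniform limits of [Wn]. *)
  set (W := fun t => RInt (fun s => K s * pos_pow (P s - L s) a) 0 t).
  assert (HW : forall t, is_derive W t (K t * pos_pow (P t - L t) a)).
  { intros t; apply (is_derive_primitive (fun s => K s * pos_pow (P s - L s) a)).
    intros s; apply continuous_rhs; [apply Ha|apply HK|apply HP|apply HLc]. }
  assert (HW0 : W 0 = 0) by apply RInt_same.
  exists W; split; [exact HW0|].
  assert (HWn : forall n t, 0 <= t <= 1 ->
            Rabs (Wn n t - W t) <= Kb * pos_pow (M * dl n + er n) a).
  { intros n t Ht; set (e := Kb * pos_pow (M * dl n + er n) a).
    assert (He : 0 <= e) by (apply Rmult_le_pos; [assumption|apply pos_pow_ge0]).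
    assert (Hd : forall s, 0 <= s <= 1 -> Rabs (K s * pos_pow (P s - Wn n (Rmax 0 (s - dl n))) a
                   - K s * pos_pow (P s - L s) a) <= e).
    { intros s Hs; apply Hrhs.
      replace (Wn n (Rmax 0 (s - dl n)) - L s)
        with ((Wn n (Rmax 0 (s - dl n)) - Wn n s) + (Wn n s - L s)) by ring.
      eapply Rle_trans; [apply Rabs_triang|].
      apply Rplus_le_compat; [apply Hdelay, Hs|apply HWL, Hs]. }
    assert (Hder' : forall c s, 0 <= s <= 1 -> is_derive (fun s => Wn n s - W s - c * s) s
              (K s * pos_pow (P s - Wn n (Rmax 0 (s - dl n))) a
                   - K s * pos_pow (P s - L s) a - c)).
    { intros c s Hs.
      apply (is_derive_minus (fun s => Wn n s - W s) (fun s => c * s)).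
      - apply (is_derive_minus (Wn n) W); [apply Hder, Hs|apply HW].
      - auto_derive; [exact I|ring]. }
    apply Rabs_le; split.
    - assert (Wn n 0 - W 0 - (- e) * 0 <= Wn n t - W t - (- e) * t).
      { apply (nondecreasing_of_derive (fun s => Wn n s - W s - (- e) * s)); [apply Ht| |].
        - intros s Hs; eapply continuous_of_is_derive, Hder'; lra.
        - intros s Hs; eexists; split; [apply Hder'; lra|].
          assert (Hs' : 0 <= s <= 1) by lra.
          pose proof (proj1 (Rabs_le_between _ _) (Hd s Hs')); lra. }
      rewrite H0, HW0 in H; nra.
    - assert (Wn n t - W t - e * t <= Wn n 0 - W 0 - e * 0).
      { apply (nonincreasing_of_derive (fun s => Wn n s - W s - e * s)); [apply Ht| |].
        - intros s Hs; eapply continuous_of_is_derive, Hder'; lra.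
        - intros s Hs; eexists; split; [apply Hder'; lra|].
          assert (Hs' : 0 <= s <= 1) by lra.
          pose proof (proj1 (Rabs_le_between _ _) (Hd s Hs')); lra. }
      rewrite H0, HW0 in H; nra. }
  assert (HWL' : forall t, 0 <= t <= 1 -> W t = L t).
  { intros t Ht; apply Rminus_diag_uniq, Rabs_eq_0.
    apply Rle_antisym; [|apply Rabs_pos]; apply le_epsilon; intros eps Heps.
    destruct (pos_pow_small a (eps / 2 / (Kb + 1)) (proj1 Ha)) as [d [Hd Hpd]].
    { apply Rdiv_lt_0_compat; lra. }
    destruct (Hsmall (Rmin (d / 2) (eps / 2))) as [N HN]; [apply Rmin_glb_lt; lra|].
    destruct (HN N (le_n N)) as [HN1 HN2].
    pose proof (Rmin_l (d / 2) (eps / 2)); pose proof (Rmin_r (d / 2) (eps / 2)).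
    specialize (Hpd (M * dl N + er N)).
    assert (Hp : pos_pow (M * dl N + er N) a <= eps / 2 / (Kb + 1)) by (apply Hpd; lra).
    apply (Rmult_le_compat_l (Kb + 1)) in Hp; [|lra].
    replace ((Kb + 1) * (eps / 2 / (Kb + 1))) with (eps / 2) in Hp by (field; lra).
    pose proof (pos_pow_ge0 (M * dl N + er N) a).
    pose proof (proj1 (Rabs_le_between _ _) (HWL N t Ht)).
    pose proof (proj1 (Rabs_le_between _ _) (HWn N t Ht)).
    apply Rabs_le; lra. }
  intros t Ht; rewrite (HWL' t Ht); apply HW.
Qed.

(** * The trajectory in the phase plane *)

Lemma is_derive_flip (f : R -> R) (t l : R) :
  is_derive f (- t) l -> is_derive (fun t => - f (- t)) t l.
Proof.
  intros Hf; eapply is_derive_eq.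
  - apply (is_derive_opp (fun t => f (- t))), (is_derive_comp f (fun t => - t)); [exact Hf|].
    apply (is_derive_opp (fun t : R => t)), is_derive_id.
  - unfold scal, opp, one; simpl; unfold mult; simpl; ring.
Qed.

(** The substitution [W t = - Y (- t)] with [P = 0] turns an equation increasing in [Y] into the
    decreasing form of [ode_gap]: what repels forward contracts backward. *)
Lemma backward_gap (k Y1 Y2 r1 r2 : R -> R) (a E u0 u1 : R) :
  0 < a -> 0 <= E -> u0 <= u1 -> (forall u, u0 < u < u1 -> 0 <= k u) ->
  (forall u, u0 <= u <= u1 -> continuous Y1 u) ->
  (forall u, u0 <= u <= u1 -> continuous Y2 u) ->
  (forall u, u0 < u < u1 -> is_derive Y1 u (k u * pos_pow (Y1 u) a + r1 u)) ->
  (forall u, u0 < u < u1 -> is_derive Y2 u (k u * pos_pow (Y2 u) a + r2 u)) ->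
  (forall u, u0 < u < u1 -> r1 u - r2 u <= E) ->
  Y2 u1 <= Y1 u1 -> Y2 u0 - Y1 u0 <= E * (u1 - u0).
Proof.
  intros Ha HE Hu Hk Hc1 Hc2 Hd1 Hd2 Hr H1.
  assert (Hgap : - Y1 (- - u0) - - Y2 (- - u0) <= E * (- u0 - - u1)).
  { apply (ode_gap (fun t => k (- t)) (fun _ => 0) (fun t => - Y1 (- t)) (fun t => - Y2 (- t))
             (fun t => r1 (- t)) (fun t => r2 (- t)) a); try assumption; try lra.
    - intros t Ht; apply Hk; lra.
    - intros t Ht; apply (continuous_opp (fun t => Y1 (- t)) t), continuous_flip, Hc1; lra.
    - intros t Ht; apply (continuous_opp (fun t => Y2 (- t)) t), continuous_flip, Hc2; lra.
    - intros t Ht; replace (0 - - Y1 (- t)) with (Y1 (- t)) by ring.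
      apply is_derive_flip, Hd1; lra.
    - intros t Ht; replace (0 - - Y2 (- t)) with (Y2 (- t)) by ring.
      apply is_derive_flip, Hd2; lra.
    - intros t Ht; apply Hr; lra.
    - rewrite !Ropp_involutive; lra. }
  rewrite !Ropp_involutive in Hgap; lra.
Qed.

(** [Y = z^(q+1)] turns [z' = c + h - f / z^q] into an equation without singularity
    at [z = 0]. *)
Definition power_sol (q c : R) (h f Y : R -> R) : Prop :=
  (forall u, 0 <= u <= 1 -> continuous Y u) /\ Y 1 = 0 /\
  (forall u, 0 < u < 1 ->
     is_derive Y u ((q + 1) * ((c + h u) * pos_pow (Y u) (q / (q + 1)) - f u))).

Lemma power_exp_bounds (q : R) : 0 < q -> 0 < q / (q + 1) <= 1.
Proof.
  intros Hq; split; [apply Rdiv_lt_0_compat; lra|].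
  apply (Rmult_le_reg_r (q + 1)); [lra|].
  replace (q / (q + 1) * (q + 1)) with q by (field; lra); lra.
Qed.

(** With [P' = - (q + 1) f], the function [W(t) = P(1 - t) - Y(1 - t)] satisfies
    [W' = K (P(1 - t) - W)_+^(q/(q+1))], in which [f] no longer appears. [W] is nondecreasing from
    0, whence [Y <= P]. *)
Lemma power_sol_exists (q c hb Pb : R) (h f P : R -> R) :
  0 < q -> 0 <= c -> (forall u, continuous h u) -> (forall u, 0 < h u <= hb) ->
  (forall u, continuous P u) -> (forall u, P u <= Pb) -> P 1 = 0 ->
  (forall u, 0 < u < 1 -> is_derive P u (- ((q + 1) * f u))) ->
  exists Y, power_sol q c h f Y /\ forall u, 0 <= u <= 1 -> Y u <= P u.
Proof.
  intros Hq Hc Hh Hhb HP HPb HP1 HdP.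
  pose proof (power_exp_bounds q Hq) as Ha.
  assert (Hflip : forall t : R, is_derive (fun t => 1 - t) t (- 1)).
  { intros t; auto_derive; [exact I|ring]. }
  assert (Hcflip : forall t : R, continuous (fun t => 1 - t) t).
  { intros t; eapply continuous_of_is_derive, Hflip. }
  set (K := fun t => (q + 1) * (c + h (1 - t))).
  destruct (ode_exists K (fun t => P (1 - t)) (q / (q + 1)) ((q + 1) * (c + hb)) Pb Ha)
    as [W [HW0 HW]].
  - intros t; apply continuous_Rmult; [apply continuous_const|].
    apply continuous_Rplus; [apply continuous_const|].
    apply (continuous_comp (fun t => 1 - t) h); [apply Hcflip|apply Hh].
  - intros t; apply (continuous_comp (fun t => 1 - t) P); [apply Hcflip|apply HP].
  - intros t; unfold K; specialize (Hhb (1 - t)); split.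
    + apply Rmult_le_pos; lra.
    + apply Rmult_le_compat_l; lra.
  - intros t; apply HPb.
  - assert (HWf : forall u, 0 <= u <= 1 -> is_derive (fun u => W (1 - u)) u
        (- (K (1 - u) * pos_pow (P u - W (1 - u)) (q / (q + 1))))).
    { intros u Hu; eapply is_derive_eq.
      - apply (is_derive_comp W (fun u => 1 - u)); [apply HW; lra|apply Hflip].
      - unfold scal; simpl; unfold mult; simpl.
        replace (1 - (1 - u)) with u by ring; ring. }
    exists (fun u => P u - W (1 - u)); split; [split; [|split]|].
    + intros u Hu; apply continuous_Rminus; [apply HP|].
      eapply continuous_of_is_derive, HWf, Hu.
    + rewrite HP1, Rminus_diag, HW0; ring.
    + intros u Hu; eapply is_derive_eq.
      * apply (is_derive_minus P (fun u => W (1 - u))); [apply HdP, Hu|apply HWf; lra].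
      * unfold minus, plus, opp; simpl; unfold K.
        replace (1 - (1 - u)) with u by ring; ring.
    + intros u Hu.
      assert (W 0 <= W (1 - u)); [|lra].
      apply nondecreasing_of_derive; [lra| |].
      * intros t Ht; eapply continuous_of_is_derive, HW; lra.
      * intros t Ht; eexists; split; [apply HW; lra|].
        apply Rmult_le_pos; [|apply pos_pow_ge0].
        unfold K; specialize (Hhb (1 - t)); apply Rmult_le_pos; lra.
Qed.

(** Where [Y < 0] the power term vanishes and [Y' = - (q + 1) f <= 0], so a negative value could
    never return to [Y 1 = 0]. *)
Lemma power_sol_ge0 (q c : R) (h f Y : R -> R) : 0 < q ->
  (forall u, 0 < u < 1 -> 0 <= f u) -> power_sol q c h f Y ->
  forall u, 0 <= u <= 1 -> 0 <= Y u.
Proof.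
  intros Hq Hf [HYc [HY1 HYd]] u Hu.
  destruct (Rle_lt_dec 0 (Y u)) as [|Hneg]; [assumption|exfalso].
  assert (Y 1 <= Y u); [|lra].
  apply (barrier Y (Y u) 0 u 1); [lra| |lra|].
  - intros t Ht; apply HYc; lra.
  - intros t Ht HYt; eexists; split; [apply HYd; lra|].
    rewrite pos_pow_npos by lra.
    assert (0 <= f t) by (apply Hf; lra); nra.
Qed.

(** A zero of [Y] would be an interior minimum, but there the equation gives
    [Y' = - (q + 1) f u < 0]. *)
Lemma power_sol_gt0 (q c : R) (h f Y : R -> R) (u : R) : 0 < q ->
  (forall u, 0 < u < 1 -> 0 <= f u) -> power_sol q c h f Y ->
  0 < u < 1 -> 0 < f u -> 0 < Y u.
Proof.
  intros Hq Hf HY Hu Hfu.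
  assert (H0 : forall s, 0 < s < 1 -> 0 <= Y s).
  { intros s Hs; apply (power_sol_ge0 q c h f); try assumption; lra. }
  destruct HY as [HYc [HY1 HYd]].
  destruct (H0 u Hu) as [|Hz]; [assumption|exfalso].
  assert (HD : Derive Y u = 0).
  { apply (derive_at_min Y 0 1); [assumption|eexists; apply HYd, Hu|].
    intros s Hs; rewrite <- Hz; apply H0, Hs. }
  rewrite (is_derive_unique _ _ _ (HYd u Hu)), <- Hz, pos_pow_npos in HD by lra.
  assert (0 < (q + 1) * f u) by (apply Rmult_lt_0_compat; lra); nra.
Qed.

(** The difference of speeds is treated as a perturbation of the equation for [Y2], of size at most
    [E]. This yields Lipschitz dependence on the speed, needed for the intermediate value
    theorem. *)
Lemma power_sol_gap (q c1 c2 Yb : R) (h f Y1 Y2 : R -> R) (u : R) :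
  0 < q -> 0 <= c1 -> (forall u, 0 < h u) ->
  power_sol q c1 h f Y1 -> power_sol q c2 h f Y2 ->
  (forall u, 0 <= u <= 1 -> Y2 u <= Yb) -> 0 <= u <= 1 ->
  Y2 u - Y1 u <= (q + 1) * pos_pow Yb (q / (q + 1)) * Rabs (c1 - c2).
Proof.
  intros Hq Hc1 Hh [HY1c [HY11 HY1d]] [HY2c [HY21 HY2d]] HYb Hu.
  pose proof (power_exp_bounds q Hq) as Ha.
  set (E := (q + 1) * pos_pow Yb (q / (q + 1)) * Rabs (c1 - c2)).
  assert (HE : 0 <= E).
  { apply Rmult_le_pos; [apply Rmult_le_pos; [lra|apply pos_pow_ge0]|apply Rabs_pos]. }
  apply (Rle_trans _ (E * (1 - u))); [|nra].
  apply (backward_gap (fun u => (q + 1) * (c1 + h u)) Y1 Y2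
    (fun u => - ((q + 1) * f u))
    (fun u => (q + 1) * ((c2 - c1) * pos_pow (Y2 u) (q / (q + 1)) - f u))
    (q / (q + 1))); try (apply Ha); try lra.
  - intros t Ht; specialize (Hh t); apply Rmult_le_pos; lra.
  - intros t Ht; apply HY1c; lra.
  - intros t Ht; apply HY2c; lra.
  - intros t Ht; eapply is_derive_eq; [apply HY1d; lra|ring].
  - intros t Ht; eapply is_derive_eq; [apply HY2d; lra|ring].
  - intros t Ht; apply (Rle_trans _ ((q + 1) * pos_pow (Y2 t) (q / (q + 1)) * (c1 - c2))).
    + apply Req_le; ring.
    + assert (H0 : 0 <= (q + 1) * pos_pow (Y2 t) (q / (q + 1)))
        by (apply Rmult_le_pos; [lra|apply pos_pow_ge0]).
      apply (Rle_trans _ ((q + 1) * pos_pow (Y2 t) (q / (q + 1)) * Rabs (c1 - c2))).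
      * apply Rmult_le_compat_l; [assumption|apply Rle_abs].
      * apply Rmult_le_compat_r; [apply Rabs_pos|].
        apply Rmult_le_compat_l; [lra|].
        apply pos_pow_le; [apply Ha|apply HYb; lra].
Qed.

(** The return from [Y] to [z = Y^(1/(q+1))]: the factor [Y^(1/(q+1) - 1)] from the chain rule is
    the inverse of [Y^(q/(q+1))], which leaves [c + h] bare and turns [f] into [f / z^q]. *)
Lemma is_derive_root (q k fu : R) (Y : R -> R) (u : R) : 0 < q -> 0 < Y u ->
  is_derive Y u ((q + 1) * (k * pos_pow (Y u) (q / (q + 1)) - fu)) ->
  is_derive (fun u => pos_pow (Y u) (1 / (q + 1))) u
    (k - fu * Rpower (pos_pow (Y u) (1 / (q + 1))) (- q)).
Proof.
  intros Hq HY Hd; eapply is_derive_eq.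
  - apply (is_derive_comp (fun x => pos_pow x (1 / (q + 1))) Y); [|exact Hd].
    apply is_derive_pos_pow, HY.
  - unfold scal; simpl; unfold mult; simpl.
    rewrite !pos_powE, Rpower_mult by assumption.
    replace (1 / (q + 1) * - q) with (1 / (q + 1) - 1) by (field; lra).
    set (A := Rpower (Y u) (1 / (q + 1) - 1)); set (B := Rpower (Y u) (q / (q + 1))).
    assert (HAB : A * B = 1).
    { unfold A, B; rewrite <- Rpower_plus.
      replace (1 / (q + 1) - 1 + q / (q + 1)) with 0 by (field; lra).
      apply Rpower_O, HY. }
    transitivity (k * (A * B) - fu * A); [field; lra|rewrite HAB; ring].
Qed.

Lemma continuous_root (q : R) (Y : R -> R) (u : R) : 0 < q -> continuous Y u ->
  continuous (fun u => pos_pow (Y u) (1 / (q + 1))) u.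
Proof.
  intros Hq HY; apply (continuous_comp Y (fun x => pos_pow x (1 / (q + 1)))); [exact HY|].
  apply continuous_pos_pow, Rdiv_lt_0_compat; lra.
Qed.

(** This is the explicit solution of the equation for [Y] wherever [f = 0], since the power [q] of
    [c u + H(u)] is the power [q / (q + 1)] of the function itself. *)
Lemma is_derive_power_primitive (q c : R) (h : R -> R) (u : R) : 0 < q ->
  (forall u, continuous h u) -> 0 < c * u + RInt h 0 u ->
  is_derive (fun u => pos_pow (c * u + RInt h 0 u) (q + 1)) u
    ((q + 1) * ((c + h u) * pos_pow (c * u + RInt h 0 u) q)).
Proof.
  intros Hq Hh Hpos; eapply is_derive_eq.
  - apply (is_derive_comp (fun x => pos_pow x (q + 1)) (fun u => c * u + RInt h 0 u));
      [apply is_derive_pos_pow, Hpos|].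
    apply (is_derive_plus (fun u => c * u) (fun u => RInt h 0 u)).
    + apply (is_derive_scal (fun u => u)), is_derive_id.
    + apply is_derive_primitive, Hh.
  - unfold scal, plus, one; simpl; unfold mult, one; simpl.
    rewrite pos_powE by assumption; replace (q + 1 - 1) with q by ring; ring.
Qed.

Lemma continuous_power_primitive (q c : R) (h : R -> R) (u : R) : 0 < q ->
  (forall u, continuous h u) ->
  continuous (fun u => pos_pow (c * u + RInt h 0 u) (q + 1)) u.
Proof.
  intros Hq Hh.
  apply (continuous_comp (fun u => c * u + RInt h 0 u) (fun x => pos_pow x (q + 1))).
  - apply continuous_Rplus.
    + apply continuous_Rmult; [apply continuous_const|apply continuous_id].
    + eapply continuous_of_is_derive, is_derive_primitive, Hh.
  - apply continuous_pos_pow; lra.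
Qed.

Lemma primitive_increasing (c : R) (h : R -> R) (x y : R) :
  (forall u, continuous h u) -> (forall u, x < u < y -> 0 < c + h u) -> x < y ->
  c * x + RInt h 0 x < c * y + RInt h 0 y.
Proof.
  intros Hh Hpos Hxy.
  assert (Hd : forall t, is_derive (fun t => - (c * t + RInt h 0 t)) t (- (c + h t))).
  { intros t; apply (is_derive_opp (fun t => c * t + RInt h 0 t)).
    apply (is_derive_plus (fun u => c * u) (fun u => RInt h 0 u)).
    - eapply is_derive_eq; [apply (is_derive_scal (fun u => u)), is_derive_id|].
      unfold one; simpl; ring.
    - apply is_derive_primitive, Hh. }
  assert (- (c * y + RInt h 0 y) < - (c * x + RInt h 0 x)); [|lra].
  apply (decreasing_of_derive (fun t => - (c * t + RInt h 0 t))); [assumption| |].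
  - intros t _; eapply continuous_of_is_derive, Hd.
  - intros t Ht; exists (- (c + h t)); split; [apply Hd|].
    specialize (Hpos t Ht); lra.
Qed.

Lemma primitive_gt0 (c : R) (h : R -> R) (u : R) :
  (forall u, continuous h u) -> (forall t, 0 < t < u -> 0 < c + h t) -> 0 < u ->
  0 < c * u + RInt h 0 u.
Proof.
  intros Hh Hpos Hu; pose proof (primitive_increasing c h 0 u Hh Hpos Hu) as H.
  rewrite RInt_same in H; lra.
Qed.

(** If [z = Y^(1/(q+1))] started below [H] at [theta], then [z <= H] on [[theta, 1]],
    since [z' <= h]; integrating [z^q z' = h z^q - f <= h H^q - f] over [[theta, 1]]
    contradicts [Hbig]. *)
Lemma power_sol_speed0 (q theta I : R) (h f P Y : R -> R) :
  0 < q -> 0 < theta < 1 -> (forall u, continuous h u) -> (forall u, 0 < h u) ->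
  (forall u, continuous P u) -> P 1 = 0 -> P theta = (q + 1) * I ->
  (forall u, 0 < u < 1 -> is_derive P u (- ((q + 1) * f u))) ->
  (forall u, 0 < u < 1 -> 0 <= f u) -> (forall u, theta < u < 1 -> 0 < f u) ->
  power_sol q 0 h f Y ->
  pos_pow (RInt h 0 1) (q + 1) < (q + 1) * I ->
  pos_pow (RInt h 0 theta) (q + 1) < Y theta.
Proof.
  intros Hq Hth Hh Hhpos HP HP1 HPth HdP Hf0 Hf HY Hbig.
  pose proof (power_exp_bounds q Hq) as Ha.
  destruct (Rlt_le_dec (pos_pow (RInt h 0 theta) (q + 1)) (Y theta)) as [|Hle];
    [assumption|exfalso].
  assert (HYpos : forall u, theta < u < 1 -> 0 < Y u).
  { intros u Hu; apply (power_sol_gt0 q 0 h f); try assumption; [lra|apply Hf, Hu]. }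
  destruct HY as [HYc [HY1 HYd]].
  assert (HHpos : forall u, 0 < u -> 0 < RInt h 0 u).
  { intros u Hu; assert (H := primitive_gt0 0 h u Hh).
    rewrite Rmult_0_l, Rplus_0_l in H; apply H; [|assumption].
    intros t _; specialize (Hhpos t); lra. }
  assert (Hz : forall u, theta < u < 1 ->
            pos_pow (Y u) (1 / (q + 1)) - RInt h 0 u
            <= pos_pow (Y theta) (1 / (q + 1)) - RInt h 0 theta).
  { intros u Hu.
    apply (nonincreasing_of_derive (fun u => pos_pow (Y u) (1 / (q + 1)) - RInt h 0 u));
      [lra| |].
    - intros t Ht; apply continuous_Rminus.
      + apply continuous_root, HYc; lra.
      + eapply continuous_of_is_derive, is_derive_primitive, Hh.
    - intros t Ht; eexists; split.
      + apply (is_derive_minus (fun u => pos_pow (Y u) (1 / (q + 1))) (fun u => RInt h 0 u)).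
        * apply is_derive_root, HYd; [assumption|apply HYpos|]; lra.
        * apply is_derive_primitive, Hh.
      + unfold minus, plus, opp; simpl.
        assert (Hft : 0 < f t) by (apply Hf; lra).
        pose proof (Rmult_lt_0_compat _ _ Hft
          (Rpower_pos (pos_pow (Y t) (1 / (q + 1))) (- q))); lra. }
  assert (Hz0 : pos_pow (Y theta) (1 / (q + 1)) <= RInt h 0 theta).
  { apply (Rle_trans _ (pos_pow (pos_pow (RInt h 0 theta) (q + 1)) (1 / (q + 1)))).
    - apply pos_pow_le; [apply Rdiv_lt_0_compat; lra|assumption].
    - rewrite pos_powM; replace ((q + 1) * (1 / (q + 1))) with 1 by (field; lra).
      rewrite pos_pow_1; [lra|left; apply HHpos; lra]. }
  assert (HYH : forall u, theta < u < 1 ->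
            pos_pow (Y u) (q / (q + 1)) <= pos_pow (RInt h 0 u) q).
  { intros u Hu; replace (q / (q + 1)) with (1 / (q + 1) * q) by (field; lra).
    rewrite <- pos_powM; apply pos_pow_le; [assumption|].
    specialize (Hz u Hu); lra. }
  assert (HHd : forall t, 0 < t -> is_derive (fun u => pos_pow (0 * u + RInt h 0 u) (q + 1)) t
            ((q + 1) * (h t * pos_pow (RInt h 0 t) q))).
  { intros t Ht; eapply is_derive_eq.
    - apply is_derive_power_primitive; try assumption.
      rewrite Rmult_0_l, Rplus_0_l; apply HHpos, Ht.
    - rewrite Rmult_0_l, !Rplus_0_l; ring. }
  (* Subtracting [P] cancels [f], so what remains of the derivative is
     [(q + 1) h (Y^(q/(q+1)) - H^q) <= 0]. As [Y 1 = P 1 = 0] and [Y theta <= H(theta)^(q+1)],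
     comparing the ends gives [(q + 1) I <= H(1)^(q+1)], against [Hbig]. *)
  assert (HQ : Y 1 - P 1 - pos_pow (0 * 1 + RInt h 0 1) (q + 1)
            <= Y theta - P theta - pos_pow (0 * theta + RInt h 0 theta) (q + 1)).
  { apply (nonincreasing_of_derive
      (fun u => Y u - P u - pos_pow (0 * u + RInt h 0 u) (q + 1))); [lra| |].
    - intros t Ht; apply continuous_Rminus; [apply continuous_Rminus|].
      + apply HYc; lra.
      + apply HP.
      + eapply continuous_of_is_derive, HHd; lra.
    - intros t Ht; eexists; split.
      + apply (is_derive_minus (fun u => Y u - P u)).
        * apply (is_derive_minus Y P); [apply HYd|apply HdP]; lra.
        * apply HHd; lra.
      + unfold minus, plus, opp; simpl.
        specialize (HYH t Ht); specialize (Hhpos t).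
        assert (h t * pos_pow (Y t) (q / (q + 1)) <= h t * pos_pow (RInt h 0 t) q)
          by (apply Rmult_le_compat_l; lra).
        nra. }
  rewrite !Rmult_0_l, !Rplus_0_l in HQ; lra.
Qed.

(** A shooting argument from [Y 1 = 0]: the speed is chosen so that the backward solution meets the
    explicit one at [theta]. The zero values of [z] outside [(0, 1)] later make the flux continuous
    where the profile reaches 0 or 1. *)
Lemma trajectory_exists (q theta hb I : R) (h f P : R -> R) :
  0 < q -> 0 < theta < 1 -> (forall u, continuous h u) -> (forall u, 0 < h u <= hb) ->
  (forall u, continuous P u) -> (forall u, P u <= (q + 1) * I) ->
  P 1 = 0 -> P theta = (q + 1) * I ->
  (forall u, 0 < u < 1 -> is_derive P u (- ((q + 1) * f u))) ->
  (forall u, 0 < u <= theta -> f u = 0) -> (forall u, theta < u < 1 -> 0 < f u) ->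
  0 < I -> pos_pow (RInt h 0 1) (q + 1) < (q + 1) * I ->
  exists c z, 0 < c /\ (forall u, continuous z u) /\
    (forall u, u <= 0 \/ 1 <= u -> z u = 0) /\
    (forall u, 0 < u < 1 -> 0 < z u) /\
    (forall u, 0 < u < 1 -> is_derive z u (c + h u - f u * Rpower (z u) (- q))).
Proof.
  intros Hq Hth Hh Hhb HP HPb HP1 HPth HdP Hf0 Hfpos HI Hbig.
  pose proof (power_exp_bounds q Hq) as Ha.
  assert (Hhpos : forall u, 0 < h u) by (intros u; apply Hhb).
  assert (Hf : forall u, 0 < u < 1 -> 0 <= f u).
  { intros u Hu; destruct (Rle_lt_dec u theta); [rewrite Hf0; lra|left; apply Hfpos; lra]. }
  assert (Hrl : 0 < (q + 1) * I) by (apply Rmult_lt_0_compat; lra).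
  (* Negative speeds are replaced by 0, because the intermediate value theorem used below wants a
     function continuous on the whole line while [Y] is built only for [c >= 0]. *)
  destruct (functional_choice (fun c Y => power_sol q (Rmax 0 c) h f Y /\
              forall u, 0 <= u <= 1 -> Y u <= P u)) as [Y HY].
  { intros c; apply (power_sol_exists q (Rmax 0 c) hb ((q + 1) * I)); try assumption.
    apply Rmax_l. }
  assert (HYb : forall c u, 0 <= u <= 1 -> Y c u <= (q + 1) * I).
  { intros c u Hu; eapply Rle_trans; [apply HY, Hu|apply HPb]. }
  assert (HYth : forall c, continuous (fun c => Y c theta) c).
  { intros c; apply (lipschitz_continuous _
      ((q + 1) * pos_pow ((q + 1) * I) (q / (q + 1)))); intros c'.
    assert (Hgap : forall c1 c2, Y c2 theta - Y c1 theta <=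
      (q + 1) * pos_pow ((q + 1) * I) (q / (q + 1)) * Rabs (c2 - c1)).
    { intros c1 c2; eapply Rle_trans.
      - apply (power_sol_gap q (Rmax 0 c1) (Rmax 0 c2) ((q + 1) * I) h f); try assumption;
          [apply Rmax_l|apply HY|apply HY|apply HYb|lra].
      - apply Rmult_le_compat_l.
        + apply Rmult_le_pos; [lra|apply pos_pow_ge0].
        + rewrite (Rabs_minus_sym c2); apply Rmax_lipschitz. }
    apply Rabs_le; pose proof (Hgap c c'); pose proof (Hgap c' c).
    rewrite (Rabs_minus_sym c c') in *; lra. }
  set (G := fun c => pos_pow (c * theta + RInt h 0 theta) (q + 1) - Y c theta).
  assert (HGc : forall c, continuous G c).
  { intros c; apply continuous_Rminus; [|apply HYth].
    apply (continuous_comp (fun c => c * theta + RInt h 0 theta) (fun x => pos_pow x (q + 1))).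
    - apply (ex_derive_continuous (fun c => c * theta + RInt h 0 theta)).
      auto_derive; exact Logic.I.
    - apply continuous_pos_pow; lra. }
  assert (HHth : forall c, 0 <= c -> 0 < c * theta + RInt h 0 theta).
  { intros c Hc; apply primitive_gt0; try assumption; [|lra].
    intros t _; specialize (Hhpos t); lra. }
  assert (HG0 : G 0 < 0).
  { unfold G; rewrite Rmult_0_l, Rplus_0_l.
    assert (pos_pow (RInt h 0 theta) (q + 1) < Y 0 theta); [|lra].
    destruct (HY 0) as [HY0 _]; rewrite Rmax_left in HY0 by lra.
    apply (power_sol_speed0 q theta I h f P); assumption. }
  (* Chosen so that [c1 * theta = (q + 1) I + 1]. The base [x] is then at least this number, which
     exceeds 1, so [x^(q+1) >= x] exceeds the uniform bound [(q + 1) I] on [Y]. *)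
  set (c1 := ((q + 1) * I + 1) / theta).
  assert (Hc1 : 0 < c1) by (apply Rdiv_lt_0_compat; lra).
  assert (HG1 : 0 < G c1).
  { assert (Hth1 : 0 <= theta <= 1) by lra.
    pose proof (HYb c1 theta Hth1).
    assert ((q + 1) * I + 1 <= pos_pow (c1 * theta + RInt h 0 theta) (q + 1)); [|unfold G; lra].
    assert (Hx : (q + 1) * I + 1 <= c1 * theta + RInt h 0 theta).
    { pose proof (HHth 0 (Rle_refl 0)); unfold c1.
      replace (((q + 1) * I + 1) / theta * theta) with ((q + 1) * I + 1) by (field; lra).
      lra. }
    set (x := c1 * theta + RInt h 0 theta) in *.
    rewrite pos_powE, Rpower_plus, Rpower_1 by lra.
    assert (1 <= Rpower x q).
    { rewrite <- (Rpower_O x) by lra; apply Rle_Rpower; lra. }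
    nra. }
  destruct (IVT_gen G 0 c1 0) as [c [Hc Hc0]].
  - intros c; apply continuity_pt_filterlim, HGc.
  - rewrite Rmin_left, Rmax_right; lra.
  - rewrite Rmin_left, Rmax_right in Hc by lra.
    assert (Hcpos : 0 < c).
    { destruct (proj1 Hc) as [|<-]; [assumption|lra]. }
    destruct (HY c) as [HYc _]; rewrite Rmax_right in HYc by lra.
    set (y := Y c) in *.
    assert (Hy0 : forall u, 0 <= u <= 1 -> 0 <= y u) by (apply (power_sol_ge0 q c h f); assumption).
    assert (HypP : forall u, theta < u < 1 -> 0 < y u).
    { intros u Hu; apply (power_sol_gt0 q c h f); try assumption; [lra|apply Hfpos, Hu]. }
    destruct HYc as [Hyc [Hy1 Hyd]].
    set (C := fun u => pos_pow (c * u + RInt h 0 u) (q + 1)).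
    assert (HCd : forall u, 0 < u -> is_derive C u
       ((q + 1) * (c + h u) * pos_pow (C u) (q / (q + 1)) + 0)).
    { intros u Hu; eapply is_derive_eq.
      - apply is_derive_power_primitive; try assumption.
        apply primitive_gt0; try assumption.
        intros t _; specialize (Hhpos t); lra.
      - unfold C; rewrite pos_powM; replace ((q + 1) * (q / (q + 1))) with q by (field; lra).
        ring. }
    assert (Hyd' : forall u, 0 < u < theta -> is_derive y u
       ((q + 1) * (c + h u) * pos_pow (y u) (q / (q + 1)) + 0)).
    { intros u Hu; eapply is_derive_eq; [apply Hyd; lra|rewrite Hf0 by lra; ring]. }
    assert (Hmatch : y theta = C theta) by (unfold C, y; unfold G in Hc0; lra).
    assert (Hk : forall u, 0 < u < theta -> 0 <= (q + 1) * (c + h u)).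
    { intros u _; specialize (Hhpos u); apply Rmult_le_pos; lra. }
    assert (HCc : forall u, continuous C u)
      by (intros u; apply continuous_power_primitive; assumption).
    (* Below [theta] both functions solve the equation with [f = 0], so equality at [theta]
       propagates backward by the gap estimate with [E = 0], used in both directions. This gives
       [y 0 = 0] and positivity on [(0, theta]]. *)
    assert (HyC : forall u, 0 <= u <= theta -> y u = C u).
    { intros u Hu; apply Rle_antisym.
      - assert (y u - C u <= 0 * (theta - u)); [|lra].
        apply (backward_gap (fun u => (q + 1) * (c + h u)) C y (fun _ => 0) (fun _ => 0)
          (q / (q + 1))); try (apply Ha); try lra.
        + intros t Ht; apply Hk; lra.
        + intros t Ht; apply HCc.
        + intros t Ht; apply Hyc; lra.
        + intros t Ht; apply HCd; lra.
        + intros t Ht; apply Hyd'; lra.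
        + intros t _; lra.
      - assert (C u - y u <= 0 * (theta - u)); [|lra].
        apply (backward_gap (fun u => (q + 1) * (c + h u)) y C (fun _ => 0) (fun _ => 0)
          (q / (q + 1))); try (apply Ha); try lra.
        + intros t Ht; apply Hk; lra.
        + intros t Ht; apply Hyc; lra.
        + intros t Ht; apply HCc.
        + intros t Ht; apply Hyd'; lra.
        + intros t Ht; apply HCd; lra.
        + intros t _; lra. }
    assert (Hypos : forall u, 0 < u < 1 -> 0 < y u).
    { intros u Hu; destruct (Rle_lt_dec u theta).
      - rewrite HyC by lra; apply pos_pow_gt0, primitive_gt0; try assumption; [|lra].
        intros t _; specialize (Hhpos t); lra.
      - apply HypP; lra. }
    assert (Hz : forall u, 0 <= u <= 1 ->
              pos_pow (y (clamp u)) (1 / (q + 1)) = pos_pow (y u) (1 / (q + 1))).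
    { intros u Hu; rewrite clamp_id by assumption; reflexivity. }
    exists c, (fun u => pos_pow (y (clamp u)) (1 / (q + 1))).
    split; [assumption|split; [|split; [|split]]].
    + intros u; apply continuous_root; [assumption|].
      apply (continuous_comp clamp y); [apply continuous_clamp|apply Hyc, clamp_range].
    + intros u [Hu|Hu]; apply pos_pow_npos.
      * replace (clamp u) with 0.
        { rewrite HyC by lra; unfold C; rewrite RInt_same, pos_pow_npos; lra. }
        unfold clamp; rewrite Rmin_right, Rmax_left; lra.
      * replace (clamp u) with 1; [lra|].
        unfold clamp; rewrite Rmin_left, Rmax_right; lra.
    + intros u Hu; apply pos_pow_gt0; rewrite clamp_id by lra; apply Hypos, Hu.
    + intros u Hu.
      apply (is_derive_ext_loc (fun u => pos_pow (y u) (1 / (q + 1)))).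
      * apply (filter_imp (fun t => 0 < t /\ t < 1)).
        { intros t Ht; symmetry; apply Hz; lra. }
        apply filter_and; [apply locally_gt|apply locally_lt]; apply Hu.
      * rewrite Hz by lra; apply is_derive_root; [assumption|apply Hypos, Hu|apply Hyd, Hu].
Qed.

(** * From a trajectory to a profile *)

Lemma locally_itv (f : R -> R) (x a b : R) : continuous f x -> a < f x < b ->
  locally x (fun y => a < f y < b).
Proof.
  intros Hf [Ha Hb]; apply filter_and.
  - apply (Hf (fun y => a < y)), locally_gt, Ha.
  - apply (Hf (fun y => y < b)), locally_lt, Hb.
Qed.

(** [T] may have finite or infinite limits at 0 and 1. A finite limit means that the profile reaches
    the corresponding equilibrium at a finite point, and the generalized inverse then stays there.
    The two comparison clauses capture both cases and provide the continuity and the limits of the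
    profile. *)
Lemma increasing_inverse (T : R -> R) :
  (forall s, 0 < s < 1 -> continuous T s) ->
  (forall s t, 0 < s -> s < t -> t < 1 -> T s < T t) ->
  exists v : R -> R, (forall x, 0 <= v x <= 1) /\ (forall x, continuous v x) /\
    (forall x, 0 < v x < 1 -> T (v x) = x) /\
    (forall s x, 0 < s < 1 -> T s <= x -> s <= v x) /\
    (forall s x, 0 < s < 1 -> x <= T s -> v x <= s).
Proof.
  intros Hc Hinc.
  (* The point 0 keeps the set nonempty and gives [v x = 0] when [x] lies below all values of
     [T]. *)
  destruct (functional_choice (fun x s =>
    is_lub (fun t => t = 0 \/ (0 < t < 1 /\ T t <= x)) s)) as [v Hv].
  { intros x; destruct (completeness (fun t => t = 0 \/ (0 < t < 1 /\ T t <= x))) as [s Hs].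
    - exists 1; intros t [->|[Ht _]]; lra.
    - exists 0; left; reflexivity.
    - exists s; exact Hs. }
  assert (Hrange : forall x, 0 <= v x <= 1).
  { intros x; destruct (Hv x) as [Hub Hlub]; split.
    - apply Hub; left; reflexivity.
    - apply Hlub; intros t [->|[Ht _]]; lra. }
  assert (Hlow : forall s x, 0 < s < 1 -> T s <= x -> s <= v x).
  { intros s x Hs HT; apply (Hv x); right; split; assumption. }
  assert (Hhigh : forall s x, 0 < s < 1 -> x <= T s -> v x <= s).
  { intros s x Hs HT; apply (Hv x); intros t [->|[Ht HTt]]; [lra|].
    destruct (Rle_lt_dec t s) as [|Hst]; [assumption|].
    pose proof (Hinc s t (proj1 Hs) Hst (proj2 Ht)); lra. }
  exists v; split; [exact Hrange|split; [|split; [|split; assumption]]].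
  - intros x; apply continuous_eps; intros eps Heps; specialize (Hrange x) as Hr.
    assert (Hup : exists d, 0 < d /\ forall y, y < x + d -> v y < v x + eps).
    { destruct (Rle_lt_dec 1 (v x)) as [H1|H1].
      - exists 1; split; [lra|]; intros y _; specialize (Hrange y); lra.
      - set (b := Rmin 1 (v x + eps)).
        assert (Hb : v x < b /\ b <= 1 /\ b <= v x + eps).
        { unfold b; repeat split; [apply Rmin_glb_lt; lra|apply Rmin_l|apply Rmin_r]. }
        set (s := (v x + b) / 2).
        assert (HTs : x < T s).
        { destruct (Rlt_le_dec x (T s)) as [|HT]; [assumption|].
          assert (s <= v x) by (apply Hlow; unfold s in *; lra); unfold s in *; lra. }
        exists (T s - x); split; [lra|]; intros y Hy.
        assert (v y <= s) by (apply Hhigh; unfold s in *; lra); unfold s in *; lra. }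
    assert (Hdn : exists d, 0 < d /\ forall y, x - d < y -> v x - eps < v y).
    { destruct (Rle_lt_dec (v x) 0) as [H1|H1].
      - exists 1; split; [lra|]; intros y _; specialize (Hrange y); lra.
      - set (b := Rmax 0 (v x - eps)).
        assert (Hb : b < v x /\ 0 <= b /\ v x - eps <= b).
        { unfold b; repeat split; [apply Rmax_lub_lt; lra|apply Rmax_l|apply Rmax_r]. }
        set (s := (v x + b) / 2).
        assert (HTs : T s < x).
        { destruct (Rlt_le_dec (T s) x) as [|HT]; [assumption|].
          assert (v x <= s) by (apply Hhigh; unfold s in *; lra); unfold s in *; lra. }
        exists (x - T s); split; [lra|]; intros y Hy.
        assert (s <= v y) by (apply Hlow; unfold s in *; lra); unfold s in *; lra. }
    destruct Hup as [d1 [Hd1 H1]]; destruct Hdn as [d2 [Hd2 H2]].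
    exists (Rmin d1 d2); split; [apply Rmin_glb_lt; assumption|].
    intros y Hy; apply Rabs_def2 in Hy.
    pose proof (Rmin_l d1 d2); pose proof (Rmin_r d1 d2).
    apply Rabs_def1.
    + assert (v y < v x + eps) by (apply H1; lra); lra.
    + assert (v x - eps < v y) by (apply H2; lra); lra.
  - intros x Hx; set (s := v x) in *.
    assert (Hnear : forall m, 0 < m -> exists d, 0 < d /\ d < s /\ d < 1 - s /\
              forall t, Rabs (t - s) <= d -> Rabs (T t - T s) < m).
    { intros m Hm; destruct (proj1 (continuous_eps T s) (Hc s Hx) m Hm) as [d [Hd HT]].
      set (e := Rmin d (Rmin s (1 - s)) / 2).
      pose proof (Rmin_l d (Rmin s (1 - s))); pose proof (Rmin_r d (Rmin s (1 - s))).
      pose proof (Rmin_l s (1 - s)); pose proof (Rmin_r s (1 - s)).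
      assert (0 < Rmin d (Rmin s (1 - s))) by (repeat apply Rmin_glb_lt; lra).
      exists e; unfold e; repeat split; try lra.
      intros t Ht; apply HT; lra. }
    destruct (Rtotal_order (T s) x) as [Hlt|[Heq|Hgt]]; [exfalso|exact Heq|exfalso].
    + destruct (Hnear (x - T s)) as [d [Hd [Hd1 [Hd2 HT]]]]; [lra|].
      assert (Hb : Rabs (T (s + d) - T s) < x - T s) by (apply HT, Rabs_le; lra).
      apply Rabs_def2 in Hb.
      assert (s + d <= v x) by (apply Hlow; lra); unfold s in *; lra.
    + destruct (Hnear (T s - x)) as [d [Hd [Hd1 [Hd2 HT]]]]; [lra|].
      assert (Hb : Rabs (T (s - d) - T s) < T s - x) by (apply HT, Rabs_le; lra).
      apply Rabs_def2 in Hb.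
      assert (v x <= s - d) by (apply Hhigh; lra); unfold s in *; lra.
Qed.

Lemma p_power_neg (p s : R) : s < 0 -> p_power p s = - Rpower (- s) (p - 1).
Proof.
  intros Hs; unfold p_power; rewrite Rabs_left by assumption.
  replace (p - 1) with (p - 2 + 1) by ring.
  rewrite Rpower_plus, (Rpower_1 (- s)) by lra; ring.
Qed.

Lemma conj_exp_pred (p : R) : 1 < p -> 0 < conj_exp p - 1 /\ (conj_exp p - 1) * (p - 1) = 1.
Proof.
  intros Hp; unfold conj_exp.
  replace (p / (p - 1) - 1) with (/ (p - 1)) by (field; lra).
  split; [apply Rinv_0_lt_compat; lra|field; lra].
Qed.

Lemma continuous_Rpower (f : R -> R) (e x : R) : 0 < f x -> continuous f x ->
  continuous (fun t => Rpower (f t) e) x.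
Proof.
  intros Hpos Hf; apply (continuous_comp f (fun y => Rpower y e)); [exact Hf|].
  apply (ex_derive_continuous (fun y => Rpower y e)); eexists; apply is_derive_Rpower, Hpos.
Qed.

(** The cancellation behind the change of variable between [s] and [xi]: with speed
    [|u'| = (z / D)^q], the term [D^q g z^(-q)] times [|u'|] is [g]. *)
Lemma Rpower_pos_frac (a b q : R) : 0 < a -> 0 < b ->
  Rpower b q * Rpower a (- q) * Rpower (a / b) q = 1.
Proof.
  intros Ha Hb; unfold Rpower; rewrite <- !exp_plus, <- exp_0; f_equal.
  rewrite ln_div by assumption; ring.
Qed.

(** Since [z = D |u'|^(p-1)], the profile must satisfy [u' = - G(u)] with [G = (z / D)^q].
    Separation of variables gives it as the inverse of [T(s)], the integral of [1 / G] from [1 / 2]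
    to [s], read backward; the base point [1 / 2] only fixes the translation. *)
Lemma profile_exists (p c : R) (D h g z : R -> R) :
  1 < p -> (forall s, 0 < s < 1 -> continuous D s) -> (forall s, 0 < s < 1 -> 0 < D s) ->
  (forall s, continuous h s) -> (forall s, continuous g s) ->
  (forall s, continuous z s) -> (forall s, s <= 0 \/ 1 <= s -> z s = 0) ->
  (forall s, 0 < s < 1 -> 0 < z s) ->
  (forall s, 0 < s < 1 -> is_derive z s
     (c + h s - weight p D g s * Rpower (z s) (- (conj_exp p - 1)))) ->
  exists u, is_solution p D h g c u.
Proof.
  intros Hp HDc HD Hh Hg Hzc Hz0 Hzpos Hzd.
  destruct (conj_exp_pred p Hp) as [Hq Hqp].
  set (q := conj_exp p - 1) in *.
  set (G := fun s => Rpower (z s / D s) q).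
  assert (HzD : forall s, 0 < s < 1 -> 0 < z s / D s).
  { intros s Hs; apply Rdiv_lt_0_compat; [apply Hzpos|apply HD]; exact Hs. }
  assert (HGpos : forall s, 0 < G s) by (intros s; apply Rpower_pos).
  assert (HGc : forall s, 0 < s < 1 -> continuous G s).
  { intros s Hs; apply continuous_Rpower; [apply HzD, Hs|].
    apply continuous_Rmult; [apply Hzc|].
    apply (continuous_Rinv_comp D s); [apply HDc, Hs|].
    pose proof (HD s Hs); lra. }
  set (T := fun s => RInt (fun t => / G t) (1 / 2) s).
  assert (HTd : forall s, 0 < s < 1 -> is_derive T s (/ G s)).
  { intros s Hs; apply (is_derive_primitive_itv (fun t => / G t) 0 1); [|lra|assumption].
    intros t Ht; apply (continuous_Rinv_comp G t); [apply HGc, Ht|].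
    pose proof (HGpos t); lra. }
  assert (HTc : forall s, 0 < s < 1 -> continuous T s).
  { intros s Hs; eapply continuous_of_is_derive, HTd, Hs. }
  destruct (increasing_inverse T HTc) as [v [Hvr [Hvc [HTv [Hvlo Hvhi]]]]].
  { intros s t Hs Hst Ht.
    assert (- T t < - T s); [|lra].
    apply (decreasing_of_derive (fun t => - T t)); [assumption| |].
    - intros x Hx; apply (continuous_opp T), HTc; lra.
    - intros x Hx; exists (- / G x); split.
      + apply (is_derive_opp T), HTd; lra.
      + pose proof (Rinv_0_lt_compat _ (HGpos x)); lra. }
  assert (Hvd : forall x, 0 < v x < 1 -> is_derive v x (G (v x))).
  { intros x Hx; eapply is_derive_eq.
    - apply (is_derive_inverse T v x (/ G (v x))).
      + apply HTd, Hx.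
      + pose proof (Rinv_0_lt_compat _ (HGpos (v x))); lra.
      + apply Hvc.
      + apply (filter_imp (fun y => 0 < v y < 1)); [apply HTv|].
        apply locally_itv; [apply Hvc|exact Hx].
    - apply Rinv_inv. }
  set (u := fun xi => v (- xi)).
  assert (Huc : forall xi, continuous u xi) by (intros xi; apply continuous_flip, Hvc).
  assert (Hud : forall xi, I_set u xi -> is_derive u xi (- G (u xi))).
  { intros xi Hxi; eapply is_derive_eq.
    - apply (is_derive_comp v (fun x => - x)); [apply Hvd, Hxi|].
      apply (is_derive_opp (fun x : R => x)), is_derive_id.
    - unfold scal, opp, one; simpl; unfold mult; simpl; unfold u; ring. }
  assert (Hloc : forall xi, I_set u xi -> locally xi (I_set u)).
  { intros xi Hxi; apply locally_itv; [apply Huc|exact Hxi]. }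
  assert (HDu : forall xi, I_set u xi -> Derive u xi = - G (u xi)).
  { intros xi Hxi; apply is_derive_unique, Hud, Hxi. }
  assert (Hflux : forall xi, I_set u xi -> flux p D u xi = - z (u xi)).
  { intros xi Hxi; unfold flux; rewrite HDu by exact Hxi.
    rewrite p_power_neg by (pose proof (HGpos (u xi)); lra).
    unfold G; rewrite Ropp_involutive, Rpower_mult, Hqp, Rpower_1 by apply HzD, Hxi.
    field; pose proof (HD (u xi) Hxi); lra. }
  (* The identity holds on the whole line because [z] vanishes at 0 and 1; continuity and vanishing
     of the flux are then inherited from [z]. *)
  assert (Hflux_ext : forall xi, flux_ext p D u xi = - z (u xi)).
  { intros xi; unfold flux_ext; destruct (Rlt_dec 0 (u xi)); [destruct (Rlt_dec (u xi) 1)|].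
    - apply Hflux; split; assumption.
    - rewrite Hz0 by lra; ring.
    - rewrite Hz0 by lra; ring. }
  assert (Hfluxd : forall xi, I_set u xi ->
            is_derive (flux p D u) xi ((c + h (u xi)) * G (u xi) - g (u xi))).
  { intros xi Hxi; apply (is_derive_ext_loc (fun x => - z (u x))).
    - apply (filter_imp (I_set u)); [intros y Hy; symmetry; apply Hflux, Hy|apply Hloc, Hxi].
    - eapply is_derive_eq.
      + apply (is_derive_opp (fun x => z (u x))), (is_derive_comp z u);
          [apply Hzd, Hxi|apply Hud, Hxi].
      + unfold opp, scal; simpl; unfold mult; simpl; unfold weight; fold q.
        pose proof (Rpower_pos_frac (z (u xi)) (D (u xi)) q (Hzpos _ Hxi) (HD _ Hxi)) as H1.
        fold (G (u xi)) in H1.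
        transitivity ((c + h (u xi)) * G (u xi)
          - g (u xi) * (Rpower (D (u xi)) q * Rpower (z (u xi)) (- q) * G (u xi)));
          [ring|rewrite H1; ring]. }
  assert (HGu : forall xi, I_set u xi -> continuous (fun x => G (u x)) xi).
  { intros xi Hxi; apply (continuous_comp u G); [apply Huc|apply HGc, Hxi]. }
  assert (Hvan : forall a, a = 0 \/ a = 1 -> vanishes_as (flux_ext p D u) u a).
  { intros a Ha eps Heps.
    destruct (proj1 (continuous_eps z a) (Hzc a) eps Heps) as [d [Hd Hz]].
    exists d; split; [assumption|]; intros xi Hxi.
    specialize (Hz (u xi) Hxi); rewrite (Hz0 a), Rminus_0_r in Hz by lra.
    rewrite Hflux_ext, Rabs_Ropp; exact Hz. }
  exists u; constructor.
  - intros xi; apply Hvr.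
  - exact Huc.
  - intros xi Hxi; split; [eexists; apply Hud, Hxi|].
    apply (continuous_ext_loc _ (fun x => - G (u x))).
    + apply (filter_imp (I_set u)); [intros y Hy; symmetry; apply HDu, Hy|apply Hloc, Hxi].
    + apply (continuous_opp (fun x => G (u x))), HGu, Hxi.
  - intros xi Hxi; split; [eexists; apply Hfluxd, Hxi|].
    apply (continuous_ext_loc _ (fun x => (c + h (u x)) * G (u x) - g (u x))).
    + apply (filter_imp (I_set u)); [|apply Hloc, Hxi].
      intros y Hy; symmetry; apply is_derive_unique, Hfluxd, Hy.
    + apply continuous_Rminus.
      * apply continuous_Rmult; [|apply HGu, Hxi].
        apply continuous_Rplus; [apply continuous_const|].
        apply (continuous_comp u h); [apply Huc|apply Hh].
      * apply (continuous_comp u g); [apply Huc|apply Hg].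
  - intros xi Hxi; rewrite (is_derive_unique _ _ _ (Hfluxd xi Hxi)), HDu by exact Hxi; ring.
  - intros xi; apply (continuous_ext (fun x => - z (u x))).
    + intros x; symmetry; apply Hflux_ext.
    + apply (continuous_opp (fun x => z (u x))), (continuous_comp u z); [apply Huc|apply Hzc].
  - apply Hvan; left; reflexivity.
  - apply Hvan; right; reflexivity.
  - apply is_lim_spec; intros [eps Heps]; simpl.
    set (s := Rmax (1 / 2) (1 - eps / 2)).
    pose proof (Rmax_l (1 / 2) (1 - eps / 2)); pose proof (Rmax_r (1 / 2) (1 - eps / 2)).
    assert (s < 1) by (apply Rmax_lub_lt; lra).
    exists (- T s); intros x Hx.
    assert (s <= u x) by (apply Hvlo; unfold s in *; lra).
    pose proof (Hvr (- x)); unfold s, u in *; apply Rabs_def1; lra.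
  - apply is_lim_spec; intros [eps Heps]; simpl.
    set (s := Rmin (1 / 2) (eps / 2)).
    pose proof (Rmin_l (1 / 2) (eps / 2)); pose proof (Rmin_r (1 / 2) (eps / 2)).
    assert (0 < s) by (apply Rmin_glb_lt; lra).
    exists (- T s); intros x Hx.
    assert (u x <= s) by (apply Hvhi; unfold s in *; lra).
    pose proof (Hvr (- x)); unfold s, u in *; apply Rabs_def1; lra.
Qed.

(** * From a profile to a trajectory *)

Lemma flux_ext_in (p : R) (D u : R -> R) (xi : R) :
  I_set u xi -> flux_ext p D u xi = flux p D u xi.
Proof.
  intros [H0 H1]; unfold flux_ext.
  destruct (Rlt_dec 0 (u xi)); [destruct (Rlt_dec (u xi) 1)|]; tauto.
Qed.

Lemma flux_ext_out (p : R) (D u : R -> R) (xi : R) :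
  ~ I_set u xi -> flux_ext p D u xi = 0.
Proof.
  intros H; unfold flux_ext.
  destruct (Rlt_dec 0 (u xi)); [destruct (Rlt_dec (u xi) 1)|]; try reflexivity.
  destruct H; split; assumption.
Qed.

Lemma I_set_dec (u : R -> R) (xi : R) : 0 <= u xi <= 1 ->
  I_set u xi \/ u xi = 0 \/ u xi = 1.
Proof. unfold I_set; intros H; lra. Qed.

Lemma flux_sign (p : R) (D u : R -> R) (xi : R) : 0 < D (u xi) ->
  (0 < Derive u xi -> 0 < flux p D u xi) /\ (Derive u xi = 0 -> flux p D u xi = 0) /\
  (Derive u xi < 0 -> flux p D u xi < 0).
Proof.
  intros HD; unfold flux, p_power.
  pose proof (Rmult_lt_0_compat _ _ HD (Rpower_pos (Rabs (Derive u xi)) (p - 2))).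
  repeat split; intros Hs; [|rewrite Hs; ring|]; rewrite <- Rmult_assoc; nra.
Qed.

Section Solution.

Variables (p c theta : R) (D h g u : R -> R).
Hypotheses (Hp : 1 < p) (HD : forall s, 0 < s < 1 -> 0 < D s)
  (Hh : forall s, continuous h s) (Hch : forall s, 0 <= s <= 1 -> 0 < c + h s)
  (Hth : 0 < theta < 1)
  (Hg0 : forall s, 0 <= s <= theta -> g s = 0)
  (Hgpos : forall s, theta < s < 1 -> 0 < g s)
  (Hsol : is_solution p D h g c u).

(** [M] is the first integral of the equation without reaction: on [I_set u] its derivative is
    [- g (u xi)]. *)
Let C (s : R) := c * s + RInt h 0 s.
Let F := flux_ext p D u.
Let M (xi : R) := F xi + C (u xi).

Lemma C_0 : C 0 = 0.
Proof. unfold C; rewrite RInt_same; ring. Qed.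

Lemma C_lt (s t : R) : 0 <= s -> s < t -> t <= 1 -> C s < C t.
Proof.
  intros Hs Hst Ht; apply primitive_increasing; try assumption.
  intros x Hx; apply Hch; lra.
Qed.

Lemma C_derive (s : R) : is_derive C s (c + h s).
Proof.
  apply (is_derive_plus (fun u => c * u) (fun u => RInt h 0 u)).
  - eapply is_derive_eq; [apply (is_derive_scal (fun u => u)), is_derive_id|].
    unfold one; simpl; ring.
  - apply is_derive_primitive, Hh.
Qed.

Lemma g_ge0 (s : R) : 0 < s < 1 -> 0 <= g s.
Proof.
  intros Hs; destruct (Rle_lt_dec s theta); [rewrite Hg0|left; apply Hgpos]; lra.
Qed.

Lemma I_locally (xi : R) : I_set u xi -> locally xi (I_set u).
Proof. intros H; apply locally_itv; [apply (sol_continuous _ _ _ _ _ _ Hsol)|exact H]. Qed.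

Lemma u_derive (xi : R) : I_set u xi -> is_derive u xi (Derive u xi).
Proof. intros H; apply Derive_correct, (sol_C1 _ _ _ _ _ _ Hsol), H. Qed.

Lemma F_derive (xi : R) : I_set u xi ->
  is_derive F xi (- ((c + h (u xi)) * Derive u xi + g (u xi))).
Proof.
  intros H; apply (is_derive_ext_loc (flux p D u)).
  - apply (filter_imp (I_set u)); [|apply I_locally, H].
    intros y Hy; symmetry; apply flux_ext_in, Hy.
  - eapply is_derive_eq; [apply Derive_correct, (sol_flux_C1 _ _ _ _ _ _ Hsol), H|].
    pose proof (sol_equation _ _ _ _ _ _ Hsol xi H); lra.
Qed.

Lemma F_continuous (xi : R) : continuous F xi.
Proof. apply (sol_flux_continuous _ _ _ _ _ _ Hsol). Qed.

Lemma M_derive (xi : R) : I_set u xi -> is_derive M xi (- g (u xi)).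
Proof.
  intros H; eapply is_derive_eq.
  - apply (is_derive_plus F (fun xi => C (u xi))); [apply F_derive, H|].
    apply (is_derive_comp C u); [apply C_derive|apply u_derive, H].
  - unfold plus, scal; simpl; unfold mult; simpl; ring.
Qed.

Lemma M_continuous (xi : R) : continuous M xi.
Proof.
  apply continuous_Rplus; [apply F_continuous|].
  apply (continuous_comp u C); [apply (sol_continuous _ _ _ _ _ _ Hsol)|].
  eapply continuous_of_is_derive, C_derive.
Qed.

(** Outside [I_set u] the flux is 0 and [u] is 0 or 1, so [M] equals [C 0 = 0] or [C 1]. Thus [M] is
    differentiable off two levels, as [nonincreasing_off_levels] demands, wherever [u] touches the
    equilibria. *)
Lemma M_levels (xi : R) : M xi <> 0 -> M xi <> C 1 -> I_set u xi.
Proof.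
  intros H0 H1; destruct (I_set_dec u xi (sol_range _ _ _ _ _ _ Hsol xi)) as [|[E|E]];
    [assumption|exfalso..]; [apply H0|apply H1]; unfold M, F;
    (rewrite flux_ext_out; [|unfold I_set; lra]); rewrite E, ?C_0; ring.
Qed.

Lemma M_nonincreasing (x y : R) : x <= y -> M y <= M x.
Proof.
  intros Hxy; apply (nonincreasing_off_levels M 0 (C 1)); [assumption| |].
  - intros t _; apply M_continuous.
  - intros t _ H0 H1; exists (- g (u t)); pose proof (M_levels t H0 H1) as HI; split.
    + apply M_derive, HI.
    + pose proof (g_ge0 (u t) HI); lra.
Qed.

Lemma M_vanishes (eps : R) : 0 < eps -> exists A, forall xi, A < xi -> Rabs (M xi) < eps.
Proof.
  intros Heps.
  destruct (sol_flux_at_0 _ _ _ _ _ _ Hsol (eps / 2)) as [d1 [Hd1 HF]]; [lra|].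
  assert (HCc : continuous C 0) by (eapply continuous_of_is_derive, C_derive).
  destruct (proj1 (continuous_eps C 0) HCc (eps / 2)) as [d2 [Hd2 HC]]; [lra|].
  assert (Hd : 0 < Rmin d1 d2) by (apply Rmin_glb_lt; assumption).
  destruct (proj2 (is_lim_spec _ _ _) (sol_lim_right _ _ _ _ _ _ Hsol) (mkposreal _ Hd))
    as [A HA]; simpl in HA.
  exists A; intros xi Hxi; specialize (HA xi Hxi).
  pose proof (Rmin_l d1 d2); pose proof (Rmin_r d1 d2).
  assert (HF' := HF xi ltac:(lra)); assert (HC' := HC (u xi) ltac:(lra)).
  rewrite C_0, Rminus_0_r in HC'; fold F in HF'.
  unfold M; eapply Rle_lt_trans; [apply Rabs_triang|lra].
Qed.

Lemma M_ge0 (xi : R) : 0 <= M xi.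
Proof.
  destruct (Rle_lt_dec 0 (M xi)) as [|Hneg]; [assumption|exfalso].
  destruct (M_vanishes (- M xi)) as [A HA]; [lra|].
  pose proof (Rmax_l xi A); pose proof (Rmax_r xi A).
  assert (HM := M_nonincreasing xi (Rmax xi A + 1) ltac:(lra)).
  assert (HA' := HA (Rmax xi A + 1) ltac:(lra)).
  apply Rabs_def2 in HA'; lra.
Qed.

(** At a minimum point [xi0 < xi] of [u] the flux vanishes, so
    [M xi <= M xi0 = C (u xi0) <= C (u xi)]. *)
Lemma F_le0 (xi : R) : F xi <= 0.
Proof.
  destruct (Rle_lt_dec (F xi) 0) as [|HF]; [assumption|exfalso].
  assert (HI : I_set u xi).
  { destruct (I_set_dec u xi (sol_range _ _ _ _ _ _ Hsol xi)) as [|H]; [assumption|].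
    unfold F in HF; rewrite flux_ext_out in HF; [lra|unfold I_set; lra]. }
  assert (Hu' : 0 < Derive u xi).
  { unfold F in HF; rewrite flux_ext_in in HF by assumption.
    destruct (flux_sign p D u xi (HD _ HI)) as [_ [Hz Hn]].
    destruct (Rtotal_order (Derive u xi) 0) as [Hs|[Hs|Hs]];
      [apply Hn in Hs; lra|apply Hz in Hs; lra|exact Hs]. }
  (* As [u] tends to 1 on the left, some [A < xi] has [u A > u xi]. A minimum of [u] over [[A, xi]]
     is therefore not at [A]; since [u' > 0] at [xi], it is not at [xi] either. *)
  destruct (proj2 (is_lim_spec _ _ _) (sol_lim_left _ _ _ _ _ _ Hsol)
    (mkposreal (1 - u xi) ltac:(unfold I_set in HI; lra))) as [A0 HA0]; simpl in HA0.
  set (A := Rmin A0 xi - 1).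
  pose proof (Rmin_l A0 xi); pose proof (Rmin_r A0 xi).
  assert (HA := HA0 A ltac:(unfold A; lra)); apply Rabs_def2 in HA.
  destruct (continuity_ab_min u A xi) as [x0 [Hmin Hx0]].
  { unfold A; lra. }
  { intros t _; apply continuity_pt_filterlim, (sol_continuous _ _ _ _ _ _ Hsol). }
  assert (Hlower : u x0 < u xi).
  { destruct (proj1 (continuous_eps _ _) (proj2 (sol_C1 _ _ _ _ _ _ Hsol xi HI)) _ Hu')
      as [d1 [Hd1 Hpos]].
    destruct (I_locally xi HI) as [d2 HId].
    set (d := Rmin (Rmin d1 d2) 1 / 2).
    assert (Hd : 0 < d /\ d < d1 /\ d < d2 /\ d < 1).
    { pose proof (Rmin_l (Rmin d1 d2) 1); pose proof (Rmin_r (Rmin d1 d2) 1).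
      pose proof (Rmin_l d1 d2); pose proof (Rmin_r d1 d2); pose proof (cond_pos d2).
      assert (0 < Rmin (Rmin d1 d2) 1) by (repeat apply Rmin_glb_lt; lra).
      unfold d; lra. }
    apply (Rle_lt_trans _ (u (xi - d))); [apply Hmin; unfold A; lra|].
    assert (- u xi < - u (xi - d)); [|lra].
    apply (decreasing_of_derive (fun t => - u t)); [lra| |].
    - intros t _; apply (continuous_opp u), (sol_continuous _ _ _ _ _ _ Hsol).
    - intros t Ht; exists (- Derive u t); split.
      + apply (is_derive_opp u), u_derive, HId, Rabs_def1; unfold minus, plus, opp; simpl; lra.
      + assert (Hp' := Hpos t ltac:(apply Rabs_def1; lra)); apply Rabs_def2 in Hp'; lra. }
  assert (Hx0' : A < x0 < xi).
  { split; (apply Rnot_le_lt; intros Hle).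
    - replace A with x0 in HA by lra; lra.
    - replace xi with x0 in Hlower by lra; lra. }
  (* Either [0 < u x0 < 1] and the interior minimum gives [u' = 0], or [u x0] is an equilibrium and
     the flux is 0 by convention. *)
  assert (HF0 : F x0 = 0).
  { destruct (I_set_dec u x0 (sol_range _ _ _ _ _ _ Hsol x0)) as [HI0|Hout].
    - unfold F; rewrite flux_ext_in by assumption.
      apply flux_sign; [apply HD, HI0|].
      apply (derive_at_min u A xi); [assumption|eexists; apply u_derive, HI0|].
      intros s Hs; apply Hmin; lra.
    - apply flux_ext_out; unfold I_set; lra. }
  pose proof (M_nonincreasing x0 xi ltac:(lra)) as HM; unfold M in HM.
  pose proof (sol_range _ _ _ _ _ _ Hsol x0).
  assert (C (u x0) < C (u xi)) by (apply C_lt; unfold I_set in HI; lra).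
  lra.
Qed.

Lemma u_derive_le0 (xi : R) : I_set u xi -> Derive u xi <= 0.
Proof.
  intros HI; pose proof (F_le0 xi) as HF; unfold F in HF; rewrite flux_ext_in in HF by assumption.
  destruct (Rle_lt_dec (Derive u xi) 0) as [|H]; [assumption|].
  apply (flux_sign p D u xi (HD _ HI)) in H; lra.
Qed.

Lemma u_nonincreasing (x y : R) : x <= y -> u y <= u x.
Proof.
  intros Hxy; apply (nonincreasing_off_levels u 0 1); [assumption| |].
  - intros t _; apply (sol_continuous _ _ _ _ _ _ Hsol).
  - intros t _ H0 H1; exists (Derive u t).
    assert (HI : I_set u t)
      by (destruct (I_set_dec u t (sol_range _ _ _ _ _ _ Hsol t)) as [|[|]]; tauto).
    split; [apply u_derive, HI|apply u_derive_le0, HI].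
Qed.

(** Once [u <= theta] the reaction is off for good, so [M] keeps its value, which must
    be its limit. *)
Lemma M_tail (xi : R) : u xi <= theta -> M xi = 0.
Proof.
  intros Hu; apply Rle_antisym; [|apply M_ge0].
  assert (Hconst : forall y, xi <= y -> M xi <= M y).
  { intros y Hy; assert (- M y <= - M xi); [|lra].
    apply (nonincreasing_off_levels (fun t => - M t) 0 (- C 1)); [assumption| |].
    - intros t _; apply (continuous_opp M), M_continuous.
    - intros t Ht H0 H1.
      assert (HI : I_set u t) by (apply M_levels; lra).
      exists (- - g (u t)); split; [apply (is_derive_opp M), M_derive, HI|].
      pose proof (u_nonincreasing xi t ltac:(lra)).
      rewrite Hg0; [lra|unfold I_set in HI; lra]. }
  apply le_epsilon; intros eps Heps.
  destruct (M_vanishes eps Heps) as [A HA].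
  pose proof (Rmax_l xi A); pose proof (Rmax_r xi A).
  assert (HM := Hconst (Rmax xi A + 1) ltac:(lra)).
  assert (HA' := HA (Rmax xi A + 1) ltac:(lra)).
  apply Rabs_def2 in HA'; lra.
Qed.

(** If [u' = 0], the flux is 0. At a level at most [theta] this contradicts [M = 0], since
    [C (u xi) > 0]. Above [theta], 0 is the maximum of the flux [F], hence [F' = 0], while the
    equation gives [F' = - g (u xi) < 0]. *)
Lemma u_derive_lt0 (xi : R) : I_set u xi -> Derive u xi < 0.
Proof.
  intros HI; destruct (u_derive_le0 xi HI) as [|Hz]; [assumption|exfalso].
  assert (HF0 : F xi = 0).
  { unfold F; rewrite flux_ext_in by assumption; apply flux_sign; [apply HD, HI|exact Hz]. }
  destruct (Rle_lt_dec (u xi) theta) as [Hu|Hu].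
  - pose proof (M_tail xi Hu) as HM; unfold M in HM.
    assert (C 0 < C (u xi)) by (apply C_lt; unfold I_set in HI; lra).
    rewrite C_0 in H; lra.
  - assert (HFd : is_derive (fun t => - F t) xi (g (u xi))).
    { eapply is_derive_eq; [apply (is_derive_opp F), F_derive, HI|].
      rewrite Hz; unfold opp; simpl; ring. }
    assert (Hd0 : Derive (fun t => - F t) xi = 0).
    { apply (derive_at_min (fun t => - F t) (xi - 1) (xi + 1)); [lra|eexists; apply HFd|].
      intros s _; pose proof (F_le0 s); lra. }
    assert (Hg : g (u xi) = 0) by (rewrite <- (is_derive_unique _ _ _ HFd); exact Hd0).
    assert (0 < g (u xi)) by (apply Hgpos; unfold I_set in HI; lra); lra.
Qed.

(** Equal values would make [u] constant between [x] and [y] at a level inside [(0, 1)], where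
    [u' < 0]. Flat pieces can occur only at 0 and 1. *)
Lemma u_decreasing (x y : R) : x < y -> I_set u x \/ I_set u y -> u y < u x.
Proof.
  intros Hxy HI; destruct (u_nonincreasing x y (Rlt_le _ _ Hxy)) as [|Heq]; [assumption|].
  apply decreasing_of_derive; [assumption| |].
  - intros t _; apply (sol_continuous _ _ _ _ _ _ Hsol).
  - intros t Ht; exists (Derive u t).
    pose proof (u_nonincreasing x t ltac:(lra)); pose proof (u_nonincreasing t y ltac:(lra)).
    assert (I_set u t) by (unfold I_set in *; lra).
    split; [apply u_derive; assumption|apply u_derive_lt0; assumption].
Qed.

Lemma u_surjective (s : R) : 0 < s < 1 -> exists xi, u xi = s.
Proof.
  intros Hs.
  destruct (proj2 (is_lim_spec _ _ _) (sol_lim_left _ _ _ _ _ _ Hsol)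
    (mkposreal (1 - s) ltac:(lra))) as [A HA]; simpl in HA.
  destruct (proj2 (is_lim_spec _ _ _) (sol_lim_right _ _ _ _ _ _ Hsol)
    (mkposreal s (proj1 Hs))) as [B HB]; simpl in HB.
  specialize (HA (A - 1) ltac:(lra)); specialize (HB (B + 1) ltac:(lra)).
  apply Rabs_def2 in HA; apply Rabs_def2 in HB.
  destruct (IVT_gen u (A - 1) (B + 1) s) as [xi [_ Hxi]].
  - intros t; apply continuity_pt_filterlim, (sol_continuous _ _ _ _ _ _ Hsol).
  - split.
    + eapply Rle_trans; [apply Rmin_r|lra].
    + eapply Rle_trans; [|apply Rmax_l]; lra.
  - exists xi; exact Hxi.
Qed.

(** [X] inverts [u] on [I_set u], and [z s] is minus the flux at the point where [u = s]. The
    equation for [z] is the chain rule with [X' = 1 / u'], the formula up to [theta] is [M = 0], and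
    the limit at 1 is the vanishing of the flux in the definition of a solution. *)
Lemma solution_phase_plane : exists X z : R -> R,
  (forall s, 0 < s < 1 -> u (X s) = s) /\ (forall xi, I_set u xi -> X (u xi) = xi) /\
  (forall s, 0 < s < 1 -> 0 < z s) /\
  (forall s, 0 < s < 1 -> is_derive X s (- / Rpower (z s / D s) (conj_exp p - 1))) /\
  (forall s, 0 < s < 1 -> is_derive z s
     (c + h s - weight p D g s * Rpower (z s) (- (conj_exp p - 1)))) /\
  (forall s, 0 < s <= theta -> z s = c * s + RInt h 0 s) /\
  (forall eps, 0 < eps -> exists d, 0 < d /\ forall s, 0 < s < 1 -> 1 - d < s -> z s < eps).
Proof.
  destruct (conj_exp_pred p Hp) as [Hq Hqp]; set (q := conj_exp p - 1) in *.
  destruct (functional_choice (fun s xi => 0 < s < 1 -> u xi = s)) as [X HX].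
  { intros s; destruct (Rlt_dec 0 s) as [H0|H0]; [destruct (Rlt_dec s 1) as [H1|H1]|].
    - destruct (u_surjective s (conj H0 H1)) as [xi Hxi]; exists xi; intros _; exact Hxi.
    - exists 0; intros H; lra.
    - exists 0; intros H; lra. }
  assert (HXI : forall s, 0 < s < 1 -> I_set u (X s)).
  { intros s Hs; unfold I_set; rewrite HX; assumption. }
  assert (HXu : forall xi, I_set u xi -> X (u xi) = xi).
  { intros xi HI; pose proof (HX (u xi) HI) as HE.
    destruct (Rtotal_order (X (u xi)) xi) as [Hlt|[Heq|Hgt]]; [exfalso|exact Heq|exfalso].
    - pose proof (u_decreasing _ _ Hlt (or_intror HI)); lra.
    - pose proof (u_decreasing _ _ Hgt (or_introl HI)); lra. }
  (* [u] takes values strictly on either side of [s] at [X s - eps] and [X s + eps]; by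
     monotonicity, all levels within [d] of [s] are attained only between these two points. *)
  assert (HXc : forall s, 0 < s < 1 -> continuous X s).
  { intros s Hs; apply continuous_eps; intros eps Heps.
    pose proof (HXI s Hs) as HI; pose proof (HX s Hs) as HE.
    pose proof (u_decreasing (X s - eps) (X s) ltac:(lra) (or_intror HI)) as H1.
    pose proof (u_decreasing (X s) (X s + eps) ltac:(lra) (or_introl HI)) as H2.
    rewrite HE in H1, H2.
    pose proof (sol_range _ _ _ _ _ _ Hsol (X s - eps)).
    pose proof (sol_range _ _ _ _ _ _ Hsol (X s + eps)).
    set (d := Rmin (u (X s - eps) - s) (s - u (X s + eps))).
    assert (Hd : 0 < d /\ d <= u (X s - eps) - s /\ d <= s - u (X s + eps)).
    { unfold d; repeat split; [apply Rmin_glb_lt; lra|apply Rmin_l|apply Rmin_r]. }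
    exists d; split; [apply Hd|]; intros t Ht; apply Rabs_def2 in Ht.
    assert (Ht' : u (X t) = t) by (apply HX; lra).
    apply Rabs_def1; apply Rnot_le_lt; intros Hle.
    - pose proof (u_nonincreasing (X s + eps) (X t) ltac:(lra)); lra.
    - pose proof (u_nonincreasing (X t) (X s - eps) ltac:(lra)); lra. }
  assert (HXd : forall s, 0 < s < 1 -> is_derive X s (/ Derive u (X s))).
  { intros s Hs; pose proof (HXI s Hs) as HI; apply (is_derive_inverse u).
    - apply u_derive, HI.
    - pose proof (u_derive_lt0 _ HI); lra.
    - apply HXc, Hs.
    - apply (filter_imp (fun y => 0 < y /\ y < 1)); [apply HX|].
      apply filter_and; [apply locally_gt|apply locally_lt]; apply Hs. }
  set (z := fun s => - F (X s)).
  assert (Hz : forall s, 0 < s < 1 -> z s = D s * Rpower (- Derive u (X s)) (p - 1)).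
  { intros s Hs; pose proof (HXI s Hs) as HI.
    unfold z, F; rewrite flux_ext_in by assumption; unfold flux.
    rewrite p_power_neg by (apply u_derive_lt0, HI); rewrite HX by assumption; ring. }
  assert (Hzpos : forall s, 0 < s < 1 -> 0 < z s).
  { intros s Hs; rewrite Hz by assumption; apply Rmult_lt_0_compat;
      [apply HD, Hs|apply Rpower_pos]. }
  assert (Hu' : forall s, 0 < s < 1 -> Derive u (X s) = - Rpower (z s / D s) q).
  { intros s Hs; rewrite Hz by assumption; pose proof (HD s Hs).
    pose proof (u_derive_lt0 _ (HXI s Hs)).
    replace (D s * Rpower (- Derive u (X s)) (p - 1) / D s)
      with (Rpower (- Derive u (X s)) (p - 1)) by (field; lra).
    rewrite Rpower_mult, Rmult_comm, Rmult_comm, (Rmult_comm (p - 1)), Hqp, Rpower_1; lra. }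
  exists X, z; split; [exact HX|split; [exact HXu|split; [exact Hzpos|]]].
  split; [|split; [|split]].
  - intros s Hs; eapply is_derive_eq; [apply HXd, Hs|].
    rewrite Hu' by assumption; field.
    pose proof (Rpower_pos (z s / D s) q); lra.
  - intros s Hs; eapply is_derive_eq.
    + apply (is_derive_opp (fun s => F (X s))), (is_derive_comp F X);
        [apply F_derive, HXI, Hs|apply HXd, Hs].
    + unfold opp, scal; simpl; unfold mult; simpl; unfold weight; fold q.
      rewrite HX, Hu' by assumption.
      pose proof (Rpower_pos_frac (z s) (D s) q (Hzpos s Hs) (HD s Hs)) as H1.
      pose proof (Rpower_pos (z s / D s) q).
      set (B := Rpower (z s / D s) q) in *.
      set (A1 := Rpower (D s) q) in *; set (A2 := Rpower (z s) (- q)) in *.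
      replace (A1 * g s * A2) with (g s / B); [field; lra|].
      apply (Rmult_eq_reg_r B); [|lra].
      transitivity (g s * (A1 * A2 * B)); [rewrite H1; field; lra|ring].
  - intros s Hs; assert (Hs1 : 0 < s < 1) by lra.
    pose proof (M_tail (X s)) as HM; rewrite HX in HM by assumption.
    specialize (HM (proj2 Hs)); unfold M in HM; rewrite HX in HM by assumption.
    unfold z; unfold C in HM; lra.
  - intros eps Heps.
    destruct (sol_flux_at_1 _ _ _ _ _ _ Hsol eps Heps) as [d [Hd HF]].
    exists d; split; [assumption|]; intros s Hs Hds.
    assert (HF' := HF (X s)); rewrite HX in HF' by assumption.
    specialize (HF' ltac:(apply Rabs_def1; lra)); fold F in HF'.
    apply Rabs_def2 in HF'; unfold z; lra.
Qed.

End Solution.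

(** * Uniqueness and the wave speed *)

Lemma Rpower_opp_antitone (x y e : R) : 0 <= e -> 0 < x -> x <= y ->
  Rpower y (- e) <= Rpower x (- e).
Proof.
  intros He Hx Hxy; rewrite !Rpower_Ropp; apply Rinv_le_contravar; [apply Rpower_pos|].
  apply Rle_Rpower_l; lra.
Qed.

(** As long as [z2 > z1], the term [- f z^(-q)] and the larger speed both favour [z2], so [z2 - z1]
    cannot shrink. But [z2] tends to 0 at 1 while [z1] stays positive. *)
Lemma trajectory_antitone (q c1 c2 : R) (h f z1 z2 : R -> R) :
  0 < q -> c1 <= c2 -> (forall s, 0 < s < 1 -> 0 <= f s) ->
  (forall s, 0 < s < 1 -> 0 < z1 s) -> (forall s, 0 < s < 1 -> 0 < z2 s) ->
  (forall s, 0 < s < 1 -> is_derive z1 s (c1 + h s - f s * Rpower (z1 s) (- q))) ->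
  (forall s, 0 < s < 1 -> is_derive z2 s (c2 + h s - f s * Rpower (z2 s) (- q))) ->
  (forall eps, 0 < eps -> exists d, 0 < d /\ forall s, 0 < s < 1 -> 1 - d < s -> z2 s < eps) ->
  forall s, 0 < s < 1 -> z2 s <= z1 s.
Proof.
  intros Hq Hc Hf Hz1 Hz2 Hd1 Hd2 Hlim s0 Hs0.
  destruct (Rle_lt_dec (z2 s0) (z1 s0)) as [|Hlt]; [assumption|exfalso].
  destruct (Hlim (z2 s0 - z1 s0)) as [d [Hd Hsmall]]; [lra|].
  set (s := Rmax (s0 + (1 - s0) / 2) (1 - d / 2)).
  assert (Hs : s0 < s < 1 /\ 1 - d < s).
  { unfold s; pose proof (Rmax_l (s0 + (1 - s0) / 2) (1 - d / 2)).
    pose proof (Rmax_r (s0 + (1 - s0) / 2) (1 - d / 2)).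
    repeat split; [lra|apply Rmax_lub_lt; lra|lra]. }
  assert (z1 s - z2 s <= z1 s0 - z2 s0).
  { apply (barrier (fun s => z1 s - z2 s) _ 0 s0 s); [lra| |lra|].
    - intros t Ht; apply continuous_Rminus; eapply continuous_of_is_derive;
        [apply Hd1|apply Hd2]; lra.
    - intros t Ht Hw; assert (Ht1 : 0 < t < 1) by lra; eexists; split.
      + apply (is_derive_minus z1 z2); [apply Hd1|apply Hd2]; assumption.
      + unfold minus, plus, opp; simpl.
        pose proof (Rpower_opp_antitone (z1 t) (z2 t) q ltac:(lra) (Hz1 t Ht1) ltac:(lra)) as Hr.
        pose proof (Rmult_le_compat_l _ _ _ (Hf t Ht1) Hr); lra. }
  pose proof (Hz1 s ltac:(lra)); pose proof (Hsmall s ltac:(lra) ltac:(lra)); lra.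
Qed.

Lemma weight_ge0 (p theta : R) (D g : R -> R) (s : R) :
  (forall s, 0 <= s <= theta -> g s = 0) -> (forall s, theta < s < 1 -> 0 < g s) ->
  0 < s < 1 -> 0 <= weight p D g s.
Proof.
  intros Hg0 Hgpos Hs; apply Rmult_le_pos; [left; apply Rpower_pos|].
  destruct (Rle_lt_dec s theta); [rewrite Hg0; lra|left; apply Hgpos; lra].
Qed.

(** At [theta] the value of [z] is [c theta + H(theta)], strictly increasing in the speed, whereas
    the comparison from the end 1 makes it nonincreasing. *)
Lemma speed_unique (p c1 c2 theta : R) (D h g u1 u2 : R -> R) :
  1 < p -> (forall s, 0 < s < 1 -> 0 < D s) -> (forall s, continuous h s) ->
  (forall s, 0 <= s <= 1 -> 0 < c1 + h s) -> 0 < theta < 1 ->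
  (forall s, 0 <= s <= theta -> g s = 0) -> (forall s, theta < s < 1 -> 0 < g s) ->
  is_solution p D h g c1 u1 -> is_solution p D h g c2 u2 -> c2 <= c1.
Proof.
  intros Hp HD Hh Hc1 Hth Hg0 Hgpos Hu1 Hu2.
  destruct (Rle_lt_dec c2 c1) as [|Hlt]; [assumption|exfalso].
  assert (Hc2 : forall s, 0 <= s <= 1 -> 0 < c2 + h s).
  { intros s Hs; specialize (Hc1 s Hs); lra. }
  destruct (solution_phase_plane p c1 theta D h g u1 Hp HD Hh Hc1 Hth Hg0 Hgpos Hu1)
    as [X1 [z1 [_ [_ [Hz1 [_ [Hd1 [Hi1 _]]]]]]]].
  destruct (solution_phase_plane p c2 theta D h g u2 Hp HD Hh Hc2 Hth Hg0 Hgpos Hu2)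
    as [X2 [z2 [_ [_ [Hz2 [_ [Hd2 [Hi2 Hl2]]]]]]]].
  pose proof (trajectory_antitone (conj_exp p - 1) c1 c2 h (weight p D g) z1 z2
    (proj1 (conj_exp_pred p Hp)) (Rlt_le _ _ Hlt)
    (fun s => weight_ge0 p theta D g s Hg0 Hgpos) Hz1 Hz2 Hd1 Hd2 Hl2 theta Hth) as Hle.
  rewrite Hi1, Hi2 in Hle by lra; nra.
Qed.

(** Equal speeds force equal [z], hence equal derivatives of the inverse profiles [X1] and [X2],
    whose difference is then the constant [a]. *)
Lemma translation_unique (p c theta : R) (D h g u1 u2 : R -> R) :
  1 < p -> (forall s, 0 < s < 1 -> 0 < D s) -> (forall s, continuous h s) ->
  (forall s, 0 <= s <= 1 -> 0 < c + h s) -> 0 < theta < 1 ->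
  (forall s, 0 <= s <= theta -> g s = 0) -> (forall s, theta < s < 1 -> 0 < g s) ->
  is_solution p D h g c u1 -> is_solution p D h g c u2 ->
  exists a, forall xi, u2 xi = u1 (xi + a).
Proof.
  intros Hp HD Hh Hc Hth Hg0 Hgpos Hu1 Hu2.
  destruct (solution_phase_plane p c theta D h g u1 Hp HD Hh Hc Hth Hg0 Hgpos Hu1)
    as [X1 [z1 [HuX1 [HXu1 [Hz1 [HX1 [Hd1 [Hi1 Hl1]]]]]]]].
  destruct (solution_phase_plane p c theta D h g u2 Hp HD Hh Hc Hth Hg0 Hgpos Hu2)
    as [X2 [z2 [HuX2 [HXu2 [Hz2 [HX2 [Hd2 [Hi2 Hl2]]]]]]]].
  pose proof (u_nonincreasing p c theta D h g u1 HD Hh Hc Hth Hg0 Hgpos Hu1) as Hmono1.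
  pose proof (u_nonincreasing p c theta D h g u2 HD Hh Hc Hth Hg0 Hgpos Hu2) as Hmono2.
  pose proof (proj1 (conj_exp_pred p Hp)) as Hq.
  pose proof (fun s => weight_ge0 p theta D g s Hg0 Hgpos) as Hw.
  assert (Hzz : forall s, 0 < s < 1 -> z1 s = z2 s).
  { intros s Hs; apply Rle_antisym.
    - apply (trajectory_antitone (conj_exp p - 1) c c h (weight p D g) z2 z1); auto; lra.
    - apply (trajectory_antitone (conj_exp p - 1) c c h (weight p D g) z1 z2); auto; lra. }
  assert (Hconst : forall s t, 0 < s -> s <= t -> t < 1 -> X1 t - X2 t = X1 s - X2 s).
  { assert (Hd : forall s, 0 < s < 1 -> is_derive (fun s => X1 s - X2 s) s 0).
    { intros s Hs; eapply is_derive_eq;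
        [apply (is_derive_minus X1 X2); [apply HX1|apply HX2]; exact Hs|].
      rewrite Hzz by exact Hs; unfold minus, plus, opp; simpl; ring. }
    intros s t Hs Hst Ht; apply Rle_antisym.
    - apply (nonincreasing_of_derive (fun s => X1 s - X2 s)); [assumption| |].
      + intros x Hx; eapply continuous_of_is_derive, Hd; lra.
      + intros x Hx; exists 0; split; [apply Hd|]; lra.
    - apply (nondecreasing_of_derive (fun s => X1 s - X2 s)); [assumption| |].
      + intros x Hx; eapply continuous_of_is_derive, Hd; lra.
      + intros x Hx; exists 0; split; [apply Hd|]; lra. }
  set (a := X1 (1 / 2) - X2 (1 / 2)).
  assert (HX : forall s, 0 < s < 1 -> X1 s = X2 s + a).
  { intros s Hs; unfold a; destruct (Rle_lt_dec s (1 / 2)) as [Hle|Hlt].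
    - pose proof (Hconst s (1 / 2) ltac:(lra) Hle ltac:(lra)); lra.
    - pose proof (Hconst (1 / 2) s ltac:(lra) ltac:(lra) ltac:(lra)); lra. }
  assert (Hh1 : u1 (X1 (1 / 2)) = 1 / 2) by (apply HuX1; lra).
  assert (Hh2 : u2 (X2 (1 / 2)) = 1 / 2) by (apply HuX2; lra).
  pose proof (HX (1 / 2) ltac:(lra)) as HXh.
  exists a; intros xi.
  destruct (I_set_dec u2 xi (sol_range _ _ _ _ _ _ Hu2 xi)) as [HI2|H2].
  { rewrite <- (HXu2 xi HI2) at 2; rewrite <- HX, HuX1 by exact HI2; reflexivity. }
  destruct (I_set_dec u1 (xi + a) (sol_range _ _ _ _ _ _ Hu1 (xi + a))) as [HI1|H1].
  { pose proof (HXu1 _ HI1) as HE; rewrite HX in HE by exact HI1.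
    replace xi with (X2 (u1 (xi + a))) at 1 by lra; apply HuX2, HI1. }
  (* Both values are now 0 or 1; comparison with the matched points at level [1 / 2] decides which,
     and in the same way for both profiles. *)
  destruct (Rle_lt_dec xi (X2 (1 / 2))) as [Hx|Hx].
  - pose proof (Hmono2 _ _ Hx); pose proof (Hmono1 (xi + a) (X1 (1 / 2)) ltac:(lra)); lra.
  - pose proof (Hmono2 _ _ (Rlt_le _ _ Hx)).
    pose proof (Hmono1 (X1 (1 / 2)) (xi + a) ltac:(lra)); lra.
Qed.

(** With [x = (r - 1)^(1/(r - 2))] the numerator is [1 + r x + x^r], and
    [x^(r-1) = (r - 1) x], so it equals [(1 + x) (1 + x^(r-1))]. *)
Lemma k_hat_ge1 (r : R) : 1 < r < 2 -> 1 <= k_hat r.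
Proof.
  intros Hr; unfold k_hat.
  set (x := Rpower (r - 1) (1 / (r - 2))).
  assert (Hx : 0 < x) by apply Rpower_pos.
  replace (Rpower (r - 1) (r / (r - 2))) with (Rpower x r).
  2:{ unfold x; rewrite Rpower_mult; f_equal; field; lra. }
  assert (Hx2 : Rpower x (r - 2) = r - 1).
  { unfold x; rewrite Rpower_mult; replace (1 / (r - 2) * (r - 2)) with 1 by (field; lra).
    apply Rpower_1; lra. }
  assert (Hx1 : Rpower x (r - 1) = (r - 1) * x).
  { replace (r - 1) with (r - 2 + 1) at 1 by ring.
    rewrite Rpower_plus, Hx2, Rpower_1; lra. }
  assert (Hxr : Rpower x r = (r - 1) * x * x).
  { replace r with (r - 1 + 1) at 1 by ring; rewrite Rpower_plus, Hx1, Rpower_1; lra. }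
  assert (Hsub : Rpower (1 + x) (r - 1) <= 1 + (r - 1) * x).
  { pose proof (pos_pow_subadd 1 x (r - 1) ltac:(lra) ltac:(lra) ltac:(lra)) as Hs.
    rewrite !pos_powE, Hx1 in Hs by lra.
    unfold Rpower at 2 in Hs; rewrite ln_1, Rmult_0_r, exp_0 in Hs; exact Hs. }
  assert (Hden : Rpower (1 + x) r = Rpower (1 + x) (r - 1) * (1 + x)).
  { replace r with (r - 1 + 1) at 1 by ring; rewrite Rpower_plus, (Rpower_1 (1 + x)); lra. }
  apply (Rmult_le_reg_r (Rpower (1 + x) r)); [apply Rpower_pos|].
  unfold Rdiv; rewrite Rmult_assoc, Rinv_l, Rmult_1_r, Rmult_1_l
    by (pose proof (Rpower_pos (1 + x) r); lra).
  rewrite Hxr, Hden.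
  apply (Rle_trans _ ((1 + (r - 1) * x) * (1 + x))); [apply Rmult_le_compat_r; lra|].
  apply Req_le; ring.
Qed.

(** For [p < 2] the conjugate exponent exceeds 2, so [2^(p'-1) - 1 >= 1]. For [p > 2] it lies in
    [(1, 2)] and [k_hat >= 1] makes the denominator at least [p']. *)
Lemma k_const_bounds (p : R) : 1 < p -> 0 < k_const p <= 1.
Proof.
  intros Hp; unfold k_const; destruct (conj_exp_pred p Hp) as [Hq Hqp].
  set (r := conj_exp p) in *.
  assert (Hfrac : forall a b, 0 < a -> a <= b -> 0 < a / b <= 1).
  { intros a b Ha Hab; split; [apply Rdiv_lt_0_compat; lra|].
    apply (Rmult_le_reg_r b); [lra|]; replace (a / b * b) with a by (field; lra); lra. }
  destruct (Rlt_dec p 2) as [Hp2|Hp2]; [|destruct (Req_EM_T p 2) as [->|Hp2']].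
  - apply Hfrac; [lra|].
    assert (1 < r - 1) by nra.
    assert (Rpower 2 1 <= Rpower 2 (r - 1)) by (apply Rle_Rpower; lra).
    rewrite Rpower_1 in H0; lra.
  - lra.
  - pose proof (k_hat_ge1 r ltac:(nra)).
    apply Hfrac; lra.
Qed.

(** * The weight integral and its remainder *)

(** Since [f] vanishes on [(0, theta]], the lower limit may be moved to [theta], and the improper
    integral becomes a limit at 1 alone. *)
Lemma improper_integral_tail (w f : R -> R) (theta I : R) :
  0 < theta < 1 -> (forall s, 0 < s < 1 -> continuous f s) ->
  (forall s, 0 < s < 1 -> w s = f s) -> (forall s, 0 < s <= theta -> f s = 0) ->
  is_RInt_gen w (at_right 0) (at_left 1) I ->
  forall eps, 0 < eps -> exists d, 0 < d /\ forall y, theta < y < 1 -> 1 - d < y ->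
    Rabs (RInt f theta y - I) < eps.
Proof.
  intros Hth Hf Hwf Hf0 HI eps Heps.
  destruct (HI (fun v => Rabs (v - I) < eps)) as [Q1 Q2 [d1 HQ1] [d2 HQ2] HQ].
  { exists (mkposreal eps Heps); intros v Hv; exact Hv. }
  exists d2; split; [apply cond_pos|]; intros y Hy Hyd.
  set (x := Rmin d1 theta / 2).
  assert (Hx : 0 < x < theta /\ x < d1).
  { pose proof (Rmin_l d1 theta); pose proof (Rmin_r d1 theta); pose proof (cond_pos d1).
    assert (0 < Rmin d1 theta) by (apply Rmin_glb_lt; lra); unfold x; lra. }
  assert (HQx : Q1 x).
  { apply HQ1; [|lra]; apply Rabs_def1; unfold minus, plus, opp; simpl; lra. }
  assert (HQy : Q2 y).
  { apply HQ2; [|lra]; apply Rabs_def1; unfold minus, plus, opp; simpl; lra. }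
  destruct (HQ x y HQx HQy) as [v [Hv HvI]]; simpl in Hv.
  assert (Hvf : RInt f x y = v).
  { apply (is_RInt_unique (V := R_CompleteNormedModule) f x y v).
    apply (is_RInt_ext w); [|exact Hv].
    intros s Hs; rewrite Rmin_left, Rmax_right in Hs by lra; apply Hwf; lra. }
  assert (Hex : forall a b, 0 < a -> a <= b -> b < 1 -> ex_RInt f a b).
  { intros a b Ha Hab Hb; apply (ex_RInt_continuous (V := R_CompleteNormedModule) f a b).
    intros s Hs; rewrite Rmin_left, Rmax_right in Hs by lra; apply Hf; lra. }
  assert (H0 : RInt f x theta = 0).
  { rewrite (RInt_ext (V := R_CompleteNormedModule) f (fun _ => 0)).
    - rewrite (RInt_const (V := R_CompleteNormedModule) x theta 0).
      unfold scal; simpl; unfold mult; simpl; ring.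
    - intros s Hs; rewrite Rmin_left, Rmax_right in Hs by lra; apply Hf0; lra. }
  assert (HCh : RInt f x theta + RInt f theta y = RInt f x y).
  { apply (RInt_Chasles (V := R_CompleteNormedModule) f x theta y); apply Hex; lra. }
  replace (RInt f theta y) with v by lra; exact HvI.
Qed.

(** [P u] is [r] times the integral of [f] from [u] to 1, written as [I] minus the integral from
    [theta] so that only proper integrals occur, and continued by 0 beyond 1. *)
Lemma remainder_exists (r theta I : R) (w f : R -> R) :
  0 < r -> 0 < theta < 1 -> (forall s, s < 1 -> continuous f s) ->
  (forall s, 0 < s < 1 -> w s = f s) -> (forall s, s <= theta -> f s = 0) ->
  (forall s, theta < s < 1 -> 0 < f s) ->
  is_RInt_gen w (at_right 0) (at_left 1) I ->
  0 < I /\ exists P : R -> R, (forall u, continuous P u) /\ (forall u, P u <= r * I) /\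
    P 1 = 0 /\ P theta = r * I /\
    (forall u, 0 < u < 1 -> is_derive P u (- (r * f u))).
Proof.
  intros Hr Hth Hf Hwf Hf0 Hfpos HI.
  set (Q := fun u => RInt f theta u).
  assert (HQd : forall u, u < 1 -> is_derive Q u (f u)).
  { intros u Hu; pose proof (Rmin_l theta u); pose proof (Rmin_r theta u).
    apply (is_derive_primitive_itv f (Rmin theta u - 1) 1); try lra.
    intros s Hs; apply Hf; lra. }
  assert (HQc : forall u, u < 1 -> continuous Q u).
  { intros u Hu; eapply continuous_of_is_derive, HQd, Hu. }
  assert (HQth : Q theta = 0) by apply RInt_same.
  assert (Hf_ge0 : forall u, u < 1 -> 0 <= f u).
  { intros u Hu; destruct (Rle_lt_dec u theta); [rewrite Hf0; lra|left; apply Hfpos; lra]. }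
  assert (HQmono : forall x y, x <= y -> y < 1 -> Q x <= Q y).
  { intros x y Hxy Hy; apply nondecreasing_of_derive; [assumption| |].
    - intros t Ht; apply HQc; lra.
    - intros t Ht; exists (f t); split; [apply HQd|apply Hf_ge0]; lra. }
  assert (HQ0 : forall u, u < 1 -> 0 <= Q u).
  { intros u Hu; destruct (Rle_lt_dec theta u).
    - rewrite <- HQth; apply HQmono; lra.
    - rewrite <- HQth; apply nonincreasing_of_derive; [lra| |].
      + intros t Ht; apply HQc; lra.
      + intros t Ht; exists (f t); split; [apply HQd; lra|rewrite Hf0; lra]. }
  assert (Htail := improper_integral_tail w f theta I Hth
    (fun s Hs => Hf s (proj2 Hs)) Hwf (fun s Hs => Hf0 s (proj2 Hs)) HI); fold Q in Htail.
  assert (HQI : forall u, u < 1 -> Q u <= I).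
  { intros u Hu; apply le_epsilon; intros eps Heps.
    destruct (Htail eps Heps) as [d [Hd HdQ]].
    set (y := (Rmax (Rmax theta u) (1 - d) + 1) / 2).
    pose proof (Rmax_l (Rmax theta u) (1 - d)); pose proof (Rmax_r (Rmax theta u) (1 - d)).
    pose proof (Rmax_l theta u); pose proof (Rmax_r theta u).
    assert (Rmax (Rmax theta u) (1 - d) < 1) by (repeat apply Rmax_lub_lt; lra).
    pose proof (HQmono u y ltac:(unfold y; lra) ltac:(unfold y; lra)).
    pose proof (HdQ y ltac:(unfold y; lra) ltac:(unfold y; lra)) as Hb.
    fold (Q y) in Hb; apply Rabs_def2 in Hb; lra. }
  assert (HIpos : 0 < I).
  { set (m := (theta + 1) / 2).
    apply (Rlt_le_trans _ (Q m)); [|apply HQI; unfold m; lra].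
    assert (- Q m < - Q theta); [|lra].
    apply (decreasing_of_derive (fun t => - Q t)); [unfold m; lra| |].
    - intros t Ht; apply (continuous_opp Q), HQc; unfold m in Ht; lra.
    - intros t Ht; unfold m in Ht; exists (- f t); split; [apply (is_derive_opp Q), HQd; lra|].
      pose proof (Hfpos t ltac:(lra)); lra. }
  assert (HrI : 0 < r * I) by (apply Rmult_lt_0_compat; assumption).
  split; [assumption|].
  set (P := fun u => if Rlt_dec u 1 then r * (I - Q u) else 0).
  assert (HP : forall u, u < 1 -> P u = r * (I - Q u)).
  { intros u Hu; unfold P; destruct (Rlt_dec u 1); [reflexivity|lra]. }
  assert (HP1 : forall u, 1 <= u -> P u = 0).
  { intros u Hu; unfold P; destruct (Rlt_dec u 1); [lra|reflexivity]. }
  assert (HPd : forall u, u < 1 -> is_derive P u (- (r * f u))).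
  { intros u Hu; apply (is_derive_ext_loc (fun u => r * (I - Q u))).
    - apply (filter_imp (fun y => y < 1)); [intros y Hy; symmetry; apply HP, Hy|].
      apply locally_lt, Hu.
    - eapply is_derive_eq.
      + apply (is_derive_scal (fun u => I - Q u)), (is_derive_minus (fun _ => I) Q);
          [apply is_derive_const|apply HQd, Hu].
      + unfold minus, plus, opp, zero; simpl; ring. }
  exists P; split; [|split; [|split; [|split]]].
  - intros u; destruct (Rtotal_order u 1) as [Hu|[->|Hu]].
    + eapply continuous_of_is_derive, HPd, Hu.
    (* Continuity of [P] at 1 is exactly the convergence of the improper integral. *)
    + apply continuous_eps; intros eps Heps.
      destruct (Htail (eps / r)) as [d [Hd HdQ]]; [apply Rdiv_lt_0_compat; lra|].
      exists (Rmin d (1 - theta)); split; [apply Rmin_glb_lt; lra|].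
      intros y Hy; pose proof (Rmin_l d (1 - theta)); pose proof (Rmin_r d (1 - theta)).
      rewrite (HP1 1), Rminus_0_r by lra; apply Rabs_def2 in Hy.
      destruct (Rlt_le_dec y 1) as [Hy1|Hy1].
      * rewrite HP, Rabs_mult, (Rabs_pos_eq r), Rabs_minus_sym by lra.
        pose proof (HdQ y ltac:(lra) ltac:(lra)) as Hb.
        apply (Rmult_lt_compat_l r) in Hb; [|assumption].
        replace (r * (eps / r)) with eps in Hb by (field; lra); exact Hb.
      * rewrite HP1, Rabs_R0 by assumption; assumption.
    + apply (continuous_ext_loc _ (fun _ => 0)).
      * apply (filter_imp (fun y => 1 < y)); [|apply locally_gt, Hu].
        intros y Hy; symmetry; apply HP1; lra.
      * apply continuous_const.
  - intros u; destruct (Rlt_le_dec u 1) as [Hu|Hu].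
    + rewrite HP by assumption; apply Rmult_le_compat_l; [lra|].
      pose proof (HQ0 u Hu); lra.
    + rewrite HP1; lra.
  - apply HP1; lra.
  - rewrite HP, HQth by lra; ring.
  - intros u Hu; apply HPd, Hu.
Qed.

(** * Continuation of the data to the line and conclusion *)

(** The equation sees [h] and [g] only at values of [u], which lie in [[0, 1]]; this allows passing
    to continuations of [h] and [g] to the line. *)
Lemma is_solution_ext (p c : R) (D h1 h2 g1 g2 u : R -> R) :
  (forall s, 0 <= s <= 1 -> h1 s = h2 s) -> (forall s, 0 <= s <= 1 -> g1 s = g2 s) ->
  is_solution p D h1 g1 c u -> is_solution p D h2 g2 c u.
Proof.
  intros Hh Hg []; constructor; try assumption.
  intros xi Hxi; rewrite <- Hh, <- Hg by auto; auto.
Qed.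

(** Composition with the retraction onto [[0, 1]] turns continuity relative to the interval into
    continuity on the line. *)
Lemma continuous_comp_clamp (f : R -> R) (x : R) :
  continuous_on unit_itv f -> continuous (fun s => f (clamp s)) x.
Proof.
  intros Hf; apply continuous_eps; intros eps Heps.
  destruct (Hf (clamp x) (clamp_range x) (fun v => Rabs (v - f (clamp x)) < eps)) as [d Hd].
  { exists (mkposreal eps Heps); intros v Hv; exact Hv. }
  exists d; split; [apply cond_pos|]; intros y Hy.
  apply (Hd (clamp y)); [|apply clamp_range].
  eapply Rle_lt_trans; [apply clamp_lipschitz|exact Hy].
Qed.

Theorem theorem2p7 (p : R) (D h g : R -> R) (h_m theta : R)
  (hp : 1 < p)
  (hD_C1 : C1_on open_unit_itv D)
  (hD_pos : forall u, 0 < u < 1 -> 0 < D u)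
  (hh_cont : continuous_on unit_itv h)
  (hh_min : is_min_on unit_itv h h_m)
  (htheta : 0 < theta < 1)
  (hg_cont : continuous_on unit_itv g)
  (hg_zero : forall u, 0 <= u <= theta -> g u = 0)
  (hg_pos : forall u, theta < u < 1 -> 0 < g u)
  (hg_one : g 1 = 0)
  (hint : weight_integrable p D g)
  (hh_pos : forall u, 0 <= u <= 1 -> 0 < h u)
  (hH : cap_H h 1 <=
        Rpower (k_const p * weight_integral p D g) (1 / conj_exp p)) :
  exists c_star : R,
    unique (fun c => c > - h_m /\ has_unique_solution p D h g c) c_star /\
    c_star > 0 /\ 0 > - h_m.
Proof.
  destruct (conj_exp_pred p hp) as [Hq Hqp].
  set (q := conj_exp p - 1) in *.
  set (h' := fun s => h (clamp s)); set (g' := fun s => g (clamp s)).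
  assert (Hh' : forall s, 0 <= s <= 1 -> h' s = h s).
  { intros s Hs; unfold h'; rewrite clamp_id; [reflexivity|assumption]. }
  assert (Hg' : forall s, 0 <= s <= 1 -> g' s = g s).
  { intros s Hs; unfold g'; rewrite clamp_id; [reflexivity|assumption]. }
  assert (Hh'c : forall s, continuous h' s) by (intros s; apply continuous_comp_clamp, hh_cont).
  assert (Hg'c : forall s, continuous g' s) by (intros s; apply continuous_comp_clamp, hg_cont).
  assert (Hg'0 : forall s, 0 <= s <= theta -> g' s = 0).
  { intros s Hs; rewrite Hg' by lra; apply hg_zero, Hs. }
  assert (Hg'pos : forall s, theta < s < 1 -> 0 < g' s).
  { intros s Hs; rewrite Hg' by lra; apply hg_pos, Hs. }
  assert (Hh'pos : forall s, 0 < h' s) by (intros s; apply hh_pos, clamp_range).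
  assert (HDc : forall s, 0 < s < 1 -> continuous D s).
  { intros s Hs; apply (ex_derive_continuous D), hD_C1, Hs. }
  assert (Hhm : 0 > - h_m).
  { destruct hh_min as [[x [Hx <-]] _]; specialize (hh_pos x Hx); lra. }
  (* With the continued [g'], [f] is 0 for every [s <= theta], also for [s <= 0], where nothing is
     known of [D]; it is thus continuous on the whole half-line [s < 1]. *)
  set (f := weight p D g').
  assert (Hf0 : forall s, s <= theta -> f s = 0).
  { intros s Hs; unfold f, weight; replace (g' s) with 0; [ring|].
    unfold g'; symmetry; apply hg_zero; split; [apply clamp_range|].
    apply Rmax_lub; [lra|]; eapply Rle_trans; [apply Rmin_r|exact Hs]. }
  assert (Hfc : forall s, s < 1 -> continuous f s).
  { intros s Hs; destruct (Rlt_le_dec 0 s) as [Hs0|Hs0].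
    - apply continuous_Rmult; [|apply Hg'c].
      apply continuous_Rpower; [apply hD_pos|apply HDc]; lra.
    - apply (continuous_ext_loc _ (fun _ => 0)); [|apply continuous_const].
      apply (filter_imp (fun y => y < theta)); [|apply locally_lt; lra].
      intros y Hy; symmetry; apply Hf0; lra. }
  assert (Hfpos : forall s, theta < s < 1 -> 0 < f s).
  { intros s Hs; apply Rmult_lt_0_compat; [apply Rpower_pos|apply Hg'pos, Hs]. }
  destruct (remainder_exists (q + 1) theta (weight_integral p D g) (weight p D g) f)
    as [HI [P [HPc [HPb [HP1 [HPth HPd]]]]]].
  { lra. }
  { exact htheta. }
  { exact Hfc. }
  { intros s Hs; unfold f, weight; rewrite Hg' by lra; reflexivity. }
  { exact Hf0. }
  { exact Hfpos. }
  { apply (RInt_gen_correct (V := R_CompleteNormedModule)), hint. }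
  set (I := weight_integral p D g) in *.
  assert (Hcap : cap_H h 1 = RInt h' 0 1).
  { apply (RInt_ext (V := R_CompleteNormedModule)); intros s Hs.
    rewrite Rmin_left, Rmax_right in Hs by lra; symmetry; apply Hh'; lra. }
  rewrite Hcap in hH.
  (* Raising the hypothesis to the power [p' = q + 1] gives [H(1)^(q+1) <= k(p) I <= I], and
     [I < (q + 1) I] since [I] and [q] are positive. *)
  assert (Hbig : pos_pow (RInt h' 0 1) (q + 1) < (q + 1) * I).
  { destruct (k_const_bounds p hp) as [Hk0 Hk1].
    assert (HkI : 0 < k_const p * I) by (apply Rmult_lt_0_compat; assumption).
    apply (Rle_lt_trans _ (k_const p * I)); [|nra].
    replace (1 / conj_exp p) with (1 / (q + 1)) in hH by (unfold q; f_equal; ring).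
    eapply Rle_trans; [apply pos_pow_le; [lra|exact hH]|].
    rewrite <- pos_powE, pos_powM by assumption.
    replace (1 / (q + 1) * (q + 1)) with 1 by (field; lra).
    rewrite pos_pow_1; lra. }
  destruct (continuity_ab_maj h' 0 1) as [xM [HxM _]].
  { lra. }
  { intros s _; apply continuity_pt_filterlim, Hh'c. }
  (* The maximum over [[0, 1]] bounds [h'] on the whole line, because [h'] factors through
     [clamp]. *)
  assert (Hhb : forall s, 0 < h' s <= h' xM).
  { intros s; split; [apply Hh'pos|].
    specialize (HxM (clamp s) (clamp_range s)); rewrite Hh' in HxM by apply clamp_range.
    exact HxM. }
  destruct (trajectory_exists q theta (h' xM) I h' f P) as [c [z [Hc [Hzc [Hz0 [Hzpos Hzd]]]]]];
    try assumption.
  { intros s Hs; apply Hf0, Hs. }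
  destruct (profile_exists p c D h' g' z) as [u Hu]; try assumption.
  assert (Hto : forall c u, is_solution p D h g c u -> is_solution p D h' g' c u).
  { intros c1 u1; apply is_solution_ext; intros s Hs; symmetry; auto. }
  assert (Hfrom : forall c u, is_solution p D h' g' c u -> is_solution p D h g c u).
  { intros c1 u1; apply is_solution_ext; assumption. }
  assert (Hcpos : forall c, c > - h_m -> forall s, 0 <= s <= 1 -> 0 < c + h' s).
  { intros c1 Hc1 s Hs; rewrite Hh' by assumption.
    pose proof (proj2 hh_min s Hs); lra. }
  exists c; split; [split|split; [lra|exact Hhm]].
  - split; [lra|split; [exists u; apply Hfrom, Hu|]].
    intros u1 u2 H1 H2.
    apply (translation_unique p c theta D h' g'); auto.
    apply Hcpos; lra.
  - intros c' [Hc' [[u' Hu'] _]]; apply Rle_antisym.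
    + apply (speed_unique p c' c theta D h' g' u' u); auto.
    + apply (speed_unique p c c' theta D h' g' u u'); auto.
      apply Hcpos; lra.
Qed.
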